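(* Let $m\ge 1$ be an integer, $r>0$, and for $1\le j\le m$ let $f_j$ be a non-constant analytic function on the disk $\{z\in\mathbb{C}:|z|<r\}$ with $f_j(0)\neq 0$. Let $\mathbb{D}\subset\mathbb{S}_+^m$ be a compact set and let $\mathcal{Z}:\mathbb{D}\to\{z\in\mathbb{C}:|z|<r\}$ be a continuous function such that for every $\mathbf{d}\in\mathbb{D}$, $\mathcal{Z}(\mathbf{d})$ is a strictly minimal critical point associated with the direction $\mathbf{d}$ for $(f_1,\ldots,f_m)$. Define $$F(\theta;\mathbf{d}):=i\,\theta\, d_0-\sum_{j=1}^m d_j\,\ln\left\{\frac{f_j\big(\mathcal{Z}(\mathbf{d})e^{i\theta}\big)}{f_j\big(\mathcal{Z}(\mathbf{d})\big)}\right\},$$ and, for nonzero $\mathbf{n}=(n_0,\ldots,n_m)\in\mathbb{Z}_+^{m+1}$ with $\mathbf{n}/\|\mathbf{n}\|\in\mathbb{D}$, write $\mathcal{Z}_{\mathbf{n}}:=\mathcal{Z}(\mathbf{n}/\|\mathbf{n}\|)$. Then there exists a sufficiently small $\epsilon>0$ such that: (a) (large exponent) for every compact set $\mathbb{D}_1\subset\mathbb{D}\setminus\mathcal{Z}^{-1}\{0\}$ there exists a constant $c>0$ such that $$[z^{n_0}]\prod_{j=1}^m f_j(z)^{n_j}=\frac{\mathcal{Z}_{\mathbf{n}}^{-n_0}}{2\pi}\prod_{j=1}^m\{f_j(\mathcal{Z}_{\mathbf{n}})\}^{n_j}\cdot\left(\int_{-\epsilon}^{\epsilon}\exp\left\{-\|\mathbf{n}\|\,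 F\left(\theta;\frac{\mathbf{n}}{\|\mathbf{n}\|}\right)\right\}d\theta+O\big(e^{-\|\mathbf{n}\| c}\big)\right)$$ for all nonzero $\mathbf{n}\in\mathbb{Z}_+^{m+1}$ with $\mathbf{n}/\|\mathbf{n}\|\in\mathbb{D}_1$ (the implied constant not depending on $\mathbf{n}$); (b) (small exponent) for every set $\mathbb{D}_0\subset\big(\mathcal{Z}^{-1}\{0\}+\mathbb{B}_\epsilon\big)\cap\big(\mathbb{D}\setminus\mathcal{Z}^{-1}\{0\}\big)$, $$[z^{n_0}]\prod_{j=1}^m f_j(z)^{n_j}=\frac{\mathcal{Z}_{\mathbf{n}}^{-n_0}}{2\pi}\prod_{j=1}^m\{f_j(\mathcal{Z}_{\mathbf{n}})\}^{n_j}\cdot\int_{-\pi}^{\pi}\exp\left\{-\|\mathbf{n}\|\, F\left(\theta;\frac{\mathbf{n}}{\|\mathbf{n}\|}\right)\right\}d\theta$$ for all nonzero $\mathbf{n}\in\mathbb{Z}_+^{m+1}$ with $\mathbf{n}/\|\mathbf{n}\|\in\mathbb{D}_0$.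
   Context: Notation: $\mathbb{Z}_+=\{0,1,2,\ldots\}$, $\mathbb{R}_+=[0,\infty)$. $\|\cdot\|$ is an arbitrary fixed norm on $\mathbb{R}^{m+1}$; coordinates of $\mathbf{d}\in\mathbb{R}^{m+1}$ are written $(d_0,\ldots,d_m)$. $\mathbb{S}_+^m:=\{\mathbf{d}\in\mathbb{R}_+^{m+1}:\|\mathbf{d}\|=1\}$ and $\mathbb{B}_\epsilon:=\{\mathbf{d}\in\mathbb{R}^{m+1}:\|\mathbf{d}\|<\epsilon\}$. For sets $A,B$, $A+B=\{a+b:a\in A,b\in B\}$. $[z^n]f(z)$ is the coefficient of $z^n$ in the Taylor series of $f$ at $0$. Critical points: given $\mathbf{d}\in\mathbb{R}_+^{m+1}$, a point $z\in\mathbb{C}$ with $|z|<r$ is a critical point associated with the direction $\mathbf{d}$ for $(f_1,\ldots,f_m)$ if $$\prod_{j=1}^m|f_j(z)|^{d_j}=\max_{x\in\mathbb{C}:|x|=|z|}\ \prod_{j=1}^m|f_j(x)|^{d_j}\qquad\text{and}\qquad d_0=\sum_{j=1}^m d_j\,\frac{z f_j'(z)}{f_j(z)}.$$ It is strictly minimal if the maximum is attained only at $x=z$. It is understood that $f_j(z)\ne0$ for all $1\le j\le m$ at a critical point, so that the quotients make sense, and that $0^0=1$. $\ln$ denotes the principal branch of the logarithm; in the integrals of the theorem $\epsilon$ is small enough that the arguments of the logarithms are in the domain of this branch. *)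

(* Defs.v *)
From HB Require Import structures.
From mathcomp Require Export all_boot all_order all_algebra complex.
From mathcomp Require Export all_classical all_reals all_analysis.

Set Implicit Arguments.
Unset Strict Implicit.
Unset Printing Implicit Defensive.

Import Order.TTheory GRing.Theory Num.Theory.
Export numFieldNormedType.Exports.

Local Open Scope ring_scope.
Local Open Scope complex_scope.
Local Open Scope classical_set_scope.

(* R[i] has no topology in the libraries; give it the one defined by its norm,
   so that f^`() and f^`(n) are complex derivatives for f : R[i] -> R[i]. *)
#[warning="-redundant-canonical-projection"]
HB.instance Definition _ (R : rcfType) := NormedModule.copy R[i] R[i]^o.

Section ComplexFunctions.
Context {R : realType}.
Implicit Types (z : R[i]) (f g : R[i] -> R[i]) (t : R).

(* the modulus as a real number; the norm `|z| of R[i] is R[i]-valued *)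
Definition cmod z : R := ComplexField.Normc.normc z.

Definition disk (r : R) : set R[i] := [set z | cmod z < r].

Definition analytic_on (U : set R[i]) f : Prop :=
  forall z0, U z0 -> exists a : nat -> R[i],
    \forall z \near z0,
      series (fun k => a k * (z - z0) ^+ k) @ \oo --> f z.

Definition constant_on (U : set R[i]) f : Prop :=
  exists c, forall z, U z -> f z = c.

Definition taylor_coef f (n : nat) : R[i] := (f^`(n) 0)%classic / n`!%:R.

Definition cexp z : R[i] :=
  (expR (complex.Re z))%:C * (cos (complex.Im z) +i* sin (complex.Im z)).

(* principal argument, with values in ]-pi, pi] for z != 0 *)
Definition carg z : R :=
  if complex.Im z < 0 then - acos (complex.Re z / cmod z)
  else acos (complex.Re z / cmod z).

Definition cln z : R[i] := ln (cmod z) +i* carg z.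

(* the complement of the half-line ]-oo, 0], domain of the principal branch *)
Definition slit_plane : set R[i] :=
  [set z | ~ (complex.Im z = 0 /\ complex.Re z <= 0)].

Definition cintegral (a b : R) (g : R -> R[i]) : R[i] :=
  (\int[lebesgue_measure]_(t in `[a, b]) complex.Re (g t))%R +i*
  (\int[lebesgue_measure]_(t in `[a, b]) complex.Im (g t))%R.

End ComplexFunctions.

Section Directions.
Context {R : realType} {m : nat}.
Implicit Types (N : 'rV[R]_m.+1 -> R) (d : 'rV[R]_m.+1)
  (f : 'I_m -> R[i] -> R[i]) (z : R[i]) (Z : 'rV[R]_m.+1 -> R[i]).

Definition is_norm N : Prop :=
  [/\ forall u v, N (u + v) <= N u + N v,
      forall (a : R) u, N (a *: u) = `|a| * N u
    & forall u, N u = 0 -> u = 0].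

Definition sphere_ge0 N : set 'rV[R]_m.+1 :=
  [set d : 'rV[R]_m.+1 | (forall i, 0 <= d 0 i) /\ N d = 1].

Definition norm_ball N (e : R) : set 'rV[R]_m.+1 := [set d | N d < e].

(* The functions f_1, ..., f_m are indexed by 'I_m = {0, ..., m-1}, while a
   vector (d_0, ..., d_m) is a row indexed by 'I_m.+1: for j : 'I_m, the
   coordinate that goes with f j is the one of index lift ord0 j, i.e. j + 1. *)
Definition coord0 (T : Type) (d : 'rV[T]_m.+1) : T := d 0 ord0.
Definition coordS (T : Type) (d : 'rV[T]_m.+1) (j : 'I_m) : T :=
  d 0 (lift ord0 j).

(* 0 `^ 0 = 1 and 0 `^ x = 0 for x != 0 *)
Definition weight f d z : R := \prod_(j < m) cmod (f j z) `^ coordS d j.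

Definition critical_point (r : R) f d z : Prop :=
  [/\ disk r z,
      forall j, f j z != 0,
      forall x, cmod x = cmod z -> weight f d x <= weight f d z
    & (coord0 d)%:C =
      \sum_(j < m) (coordS d j)%:C * (z * ((f j)^`() z)%classic / f j z)].

Definition strictly_minimal_critical_point (r : R) f d z : Prop :=
  critical_point r f d z /\
  forall x, cmod x = cmod z -> weight f d x = weight f d z -> x = z.

Definition log_arg f Z (t : R) d (j : 'I_m) : R[i] :=
  f j (Z d * cexp (0 +i* t)) / f j (Z d).

Definition phase f Z (t : R) d : R[i] :=
  (0 +i* (t * coord0 d))
  - \sum_(j < m) (coordS d j)%:C * cln (log_arg f Z t d j).

Definition rvec (n : 'rV[nat]_m.+1) : 'rV[R]_m.+1 := map_mx (fun k => k%:R) n.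

Definition direction N (n : 'rV[nat]_m.+1) : 'rV[R]_m.+1 :=
  (N (rvec n))^-1 *: rvec n.

Definition prod_coef f (n : 'rV[nat]_m.+1) : R[i] :=
  taylor_coef (fun z => \prod_(j < m) f j z ^+ coordS n j) (coord0 n).

Definition prefactor f z (n : 'rV[nat]_m.+1) : R[i] :=
  z ^- coord0 n / (2 * pi)%:C * \prod_(j < m) f j z ^+ coordS n j.

Definition phase_integral N f Z (a b : R) (n : 'rV[nat]_m.+1) : R[i] :=
  cintegral a b (fun t =>
    cexp (- (N (rvec n))%:C * phase f Z t (direction N n))).

End Directions.

(* Main.v *)
(* The coefficient is computed by Cauchy's formula on the circle through
   Z(n/|n|), where the integrand, divided by its value at Z(n/|n|), is
   exp(-|n| F).  Since f_j(Z(d) e^(i t)) / f_j(Z(d)) tends to 1 as t -> 0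
   uniformly in d, and as Z(d) -> 0 uniformly in t, the principal logarithms make
   sense.  Away from t = 0 the modulus of the integrand is the |n|-th power of
   a quantity that strict minimality makes < 1 and that compactness makes
   uniformly so.

   Cauchy's formula has a proof by differentiation alone.  For k holomorphic
   around a circle of centre 0, w k'(w) integrates to 0 over it, being up to a
   constant the derivative of k along the circle.  With k(w) = h(w) w^(-n) this gives
   int h w^(-n) = (1/n) int h' w^(1-n), hence by induction
   int h w^(-n) = (1/n!) int h^(n), and the last integral is 2 pi h^(n)(0) by the
   mean value property, which also follows: the derivative of
   int h(s z e^(i t)) dt in s is (1/s) int w h'(w) = 0. *)
Require Import Defs.
From mathcomp Require Import ring lra.

Set Implicit Arguments.
Unset Strict Implicit.
Unset Printing Implicit Defensive.

Import Order.TTheory GRing.Theory Num.Theory.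
Import ComplexField.

Local Open Scope ring_scope.
Local Open Scope complex_scope.
Local Open Scope classical_set_scope.

(** * The modulus and the topology of the complex numbers *)

Section Modulus.
Context {R : realType}.
Implicit Types (z w : R[i]) (e : R).

(** The radius [e] is fixed before [D1] and [D0] are given, so it can depend only on [D], while the
    rate [c] may depend on [D1]. Hence two compactness arguments of different scope: the logarithm
    arguments near t = 0 are controlled on all of [D], including the directions with [Z d = 0],
    whereas the strict inequality away from t = 0 fails at those directions, where the circle
    shrinks to a point, and is uniform only on [D1]. Each argument uses the near-covering form of
    compactness: what holds near every point for all parameters close to a limit holds on the whole
    compact set for one parameter.

    The branch of the logarithm disappears from the integrand: |n| d is the integer vector n, so
    exp(-|n| F) is a product of integer powers as soon as the logarithm arguments are nonzero. Their
    membership in the slit plane is obtained from the positivity of their real parts, an open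
    condition that holds at the value 1.

    Some [f j] may vanish on the circle through [Z d] away from [Z d], with an exponent tending to 0
    as the direction varies; this is what complicates the uniform bound on the modulus. *)

Lemma cmodE z : `|z| = (cmod z)%:C.
Proof. by []. Qed.

Lemma cmod0 : cmod (0 : R[i]) = 0.
Proof. exact: Normc.normc0. Qed.

Lemma cmod1 : cmod (1 : R[i]) = 1.
Proof. exact: Normc.normc1. Qed.

Lemma cmod_ge0 z : 0 <= cmod z.
Proof. by case: z => a b; exact: sqrtr_ge0. Qed.

Lemma cmodM z w : cmod (z * w) = cmod z * cmod w.
Proof. exact: Normc.normcM. Qed.

Lemma cmodV z : cmod z^-1 = (cmod z)^-1.
Proof. exact: Normc.normcV. Qed.

Lemma cmodX z n : cmod (z ^+ n) = cmod z ^+ n.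
Proof.
by elim: n => [|n IH]; [rewrite !expr0 cmod1 | rewrite !exprS cmodM IH].
Qed.

Lemma cmodN z : cmod (- z) = cmod z.
Proof. exact: (@normcN R z). Qed.

Lemma cmodD z w : cmod (z + w) <= cmod z + cmod w.
Proof. exact: le_normcD. Qed.

Lemma cmodBC z w : cmod (z - w) = cmod (w - z).
Proof. by rewrite -opprB cmodN. Qed.

Lemma cmodB z w : cmod (z - w) <= cmod z + cmod w.
Proof. by rewrite -(cmodN w) cmodD. Qed.

Lemma cmod_eq0 z : (cmod z == 0) = (z == 0).
Proof.
by apply/eqP/eqP => [/Normc.eq0_normc //|->]; rewrite cmod0.
Qed.

Lemma cmod_gt0 z : (0 < cmod z) = (z != 0).
Proof. by rewrite lt0r cmod_ge0 cmod_eq0 andbT. Qed.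

Lemma cmod_real (x : R) : cmod x%:C = `|x|.
Proof. by rewrite /cmod /= expr0n /= addr0 sqrtr_sqr. Qed.

Lemma cmod_nat n : cmod (n%:R : R[i]) = n%:R.
Proof. by rewrite -(rmorph_nat (real_complex R)) cmod_real normr_nat. Qed.

Lemma cmod_prod (I : Type) (s : seq I) (P : pred I) (F : I -> R[i]) :
  cmod (\prod_(i <- s | P i) F i) = \prod_(i <- s | P i) cmod (F i).
Proof. by elim/big_rec2: _ => [|i x y _ <-]; rewrite ?cmod1 ?cmodM. Qed.

Lemma cmod_sum (I : Type) (s : seq I) (P : pred I) (F : I -> R[i]) :
  cmod (\sum_(i <- s | P i) F i) <= \sum_(i <- s | P i) cmod (F i).
Proof.
elim/big_rec2: _ => [|i x y _ h]; first by rewrite cmod0.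
by apply: le_trans (cmodD _ _) _; rewrite lerD2l.
Qed.

Lemma normRe_le z : `|complex.Re z| <= cmod z.
Proof. by have := normc_ge_Re z; rewrite cmodE lecR. Qed.

Lemma normIm_le z : `|complex.Im z| <= cmod z.
Proof.
by case: z => a b /=; rewrite -sqrtr_sqr; apply: ler_wsqrtr; rewrite lerDr sqr_ge0.
Qed.

Lemma cmod_le z : cmod z <= `|complex.Re z| + `|complex.Im z|.
Proof.
case: z => a b; have -> : a +i* b = a%:C + 'i * b%:C by simpc.
apply: le_trans (cmodD _ _) _; rewrite cmodM !cmod_real /=.
by simpc; rewrite expr0n expr1n /= add0r sqrtr1 mul1r.
Qed.

(** Balls of [R[i]] have radii in [R[i]]; a positive radius is real, so epsilons and deltas can be
    taken in [R]. *)
Lemma nbhs_cmodP z (A : set R[i]) :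
  nbhs z A <-> exists2 d : R, 0 < d & forall x, cmod (x - z) < d -> A x.
Proof.
split.
- move=> /nbhs_ballP[e /= e0 sub].
  have /complex_realP[k ke] : e \is Num.real by rewrite gtr0_real.
  move: e0 sub; rewrite ke (_ : 0 = 0%:C)// ltcR => k0 sub.
  exists k => // x xz; apply: sub; rewrite -ball_normE/=.
  by rewrite distrC cmodE ltcR.
- case=> d d0 sub; apply/nbhs_ballP; exists d%:C => /=.
    by rewrite (_ : 0 = 0%:C)// ltcR.
  move=> x; rewrite -ball_normE/= distrC cmodE ltcR; exact: sub.
Qed.

Lemma cvg_cmodP (T : Type) (F : set_system T) {FF : Filter F} (u : T -> R[i]) l :
  u @ F --> l <-> forall e : R, 0 < e -> \forall x \near F, cmod (u x - l) < e.
Proof.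
split=> [ul e e0|h A].
  have := ul [set w | cmod (w - l) < e]; apply.
  by apply/nbhs_cmodP; exists e.
move=> /nbhs_cmodP[e e0 sub]; apply: filterS (h _ e0) => x; exact: sub.
Qed.

Lemma cvg_at_cmodP (f : R[i] -> R[i]) z l :
  f @ z --> l <-> forall e : R, 0 < e -> exists2 d : R, 0 < d &
    forall x, cmod (x - z) < d -> cmod (f x - l) < e.
Proof.
split=> [fl e e0|h].
  by apply/nbhs_cmodP; exact: (@cvg_cmodP _ (nbhs z) (nbhs_filter z) f l).1 fl _ e0.
by apply: (@cvg_cmodP _ (nbhs z) (nbhs_filter z) f l).2 => e /h ?; apply/nbhs_cmodP.
Qed.

End Modulus.

(** * Holomorphic functions *)

Section StrongDerivative.
Context {R : realType}.
Implicit Types (z w x y : R[i]) (f g df dg : R[i] -> R[i]) (U : set R[i]).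

(* Holomorphy with a locally uniform second order remainder; unlike mere
   differentiability it passes to limits and integrates without further
   compactness arguments on the derivative. *)
Definition strong_derivative U f df : Prop :=
  forall z0, U z0 -> exists d B : R, [/\ 0 < d, 0 < B &
    forall x y, cmod (x - z0) < d -> cmod (y - z0) < d ->
      cmod (f x - f y - df y * (x - y)) <= B * cmod (x - y) ^+ 2].

Lemma strong_derivative_cst U c : strong_derivative U (fun=> c) (fun=> 0).
Proof.
move=> z0 _; exists 1, 1; split=> // x y _ _.
by rewrite subrr mul0r subr0 cmod0 mul1r sqr_ge0.
Qed.

Lemma strong_derivative_id U : strong_derivative U id (fun=> 1).
Proof.
move=> z0 _; exists 1, 1; split=> // x y _ _.
by rewrite mul1r subrr cmod0 mul1r sqr_ge0.
Qed.

(** Writing the remainder for (x, y) and for (y, x) and adding makes f cancel, which leaves (df x -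
    df y) (x - y): the derivative is therefore Lipschitz, and all other bounds follow from that. A
    single [B] serves for the five of them, to keep products simple. *)
Lemma strong_derivative_bounds U f df z0 : strong_derivative U f df -> U z0 ->
  exists d B : R, [/\ 0 < d, 0 < B & forall x y,
    cmod (x - z0) < d -> cmod (y - z0) < d ->
    [/\ cmod (f x) <= B, cmod (df x) <= B,
        cmod (f x - f y) <= B * cmod (x - y),
        cmod (df x - df y) <= B * cmod (x - y)
      & cmod (f x - f y - df y * (x - y)) <= B * cmod (x - y) ^+ 2]].
Proof.
move=> fdf Uz0; have [d [B [d0 B0 H]]] := fdf _ Uz0.
have z0d : cmod (z0 - z0) < d by rewrite subrr cmod0.
have dfL x y : cmod (x - z0) < d -> cmod (y - z0) < d ->
    cmod (df x - df y) <= 2 * B * cmod (x - y).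
  move=> xd yd; have [->|xy] := eqVneq x y.
    by rewrite !subrr cmod0 mulr0.
  have xy0 : 0 < cmod (x - y) by rewrite cmod_gt0 subr_eq0.
  rewrite -(ler_pM2r xy0) -cmodM.
  have -> : (df x - df y) * (x - y) =
    (f x - f y - df y * (x - y)) + (f y - f x - df x * (y - x)) by ring.
  apply: le_trans (cmodD _ _) _.
  have := H _ _ yd xd; have := H _ _ xd yd; rewrite (cmodBC y x).
  move: (cmod (f x - f y - _)) (cmod (f y - f x - _)) => a b; nra.
pose A := cmod (df z0) + 2 * B * d.
have A0 : 0 < A by rewrite /A; have := cmod_ge0 (df z0); nra.
have dfA x : cmod (x - z0) < d -> cmod (df x) <= A.
  move=> xd; rewrite -[df x](subrK (df z0)) /A.
  apply: le_trans (cmodD _ _) _; rewrite addrC lerD2l.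
  apply: le_trans (dfL _ _ xd z0d) _.
  by rewrite ler_wpM2l ?ltW// mulr_gt0.
have xyd x y : cmod (x - z0) < d -> cmod (y - z0) < d -> cmod (x - y) <= 2 * d.
  move=> xd yd; have -> : x - y = (x - z0) - (y - z0) by ring.
  apply: le_trans (cmodB _ _) _; lra.
have fL x y : cmod (x - z0) < d -> cmod (y - z0) < d ->
    cmod (f x - f y) <= (A + 2 * B * d) * cmod (x - y).
  move=> xd yd.
  have -> : f x - f y = (f x - f y - df y * (x - y)) + df y * (x - y) by ring.
  apply: le_trans (cmodD _ _) _; rewrite cmodM.
  have h1 := H _ _ xd yd; have h2 := dfA _ yd; have h3 := xyd _ _ xd yd.
  have h4 := cmod_ge0 (x - y).
  have h5 : cmod (df y) * cmod (x - y) <= A * cmod (x - y) by rewrite ler_wpM2r.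
  have h6 : cmod (x - y) ^+ 2 <= 2 * d * cmod (x - y).
    by rewrite expr2 ler_wpM2r.
  have h7 : B * cmod (x - y) ^+ 2 <= B * (2 * d * cmod (x - y)).
    by rewrite ler_wpM2l// ltW.
  lra.
pose L := A + 2 * B * d.
have L0 : 0 < L by rewrite /L; nra.
pose C := cmod (f z0) + L * d.
have C0 : 0 < C by rewrite /C; have := cmod_ge0 (f z0); nra.
have fC x : cmod (x - z0) < d -> cmod (f x) <= C.
  move=> xd; rewrite -[f x](subrK (f z0)) /C.
  apply: le_trans (cmodD _ _) _; rewrite addrC lerD2l.
  apply: le_trans (fL _ _ xd z0d) _.
  by rewrite ler_wpM2l ?ltW.
exists d, (A + L + C + 2 * B); split=> // [|x y xd yd]; first lra.
have xy0 := cmod_ge0 (x - y).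
split.
- apply: le_trans (fC _ xd) _; lra.
- apply: le_trans (dfA _ xd) _; lra.
- apply: le_trans (fL _ _ xd yd) _; rewrite ler_wpM2r// -/L; lra.
- apply: le_trans (dfL _ _ xd yd) _; rewrite ler_wpM2r//; lra.
- apply: le_trans (H _ _ xd yd) _; rewrite ler_wpM2r ?sqr_ge0//; lra.
Qed.

Lemma strong_derivativeD U f df g dg :
  strong_derivative U f df -> strong_derivative U g dg ->
  strong_derivative U (fun z => f z + g z) (fun z => df z + dg z).
Proof.
move=> F G z0 Uz0.
have [d1 [B1 [d10 B10 H1]]] := F _ Uz0.
have [d2 [B2 [d20 B20 H2]]] := G _ Uz0.
exists (Num.min d1 d2), (B1 + B2); split; [by rewrite lt_min d10|lra|].
move=> x y; rewrite !lt_min => /andP[x1 x2] /andP[y1 y2].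
have -> : f x + g x - (f y + g y) - (df y + dg y) * (x - y) =
  (f x - f y - df y * (x - y)) + (g x - g y - dg y * (x - y)) by ring.
by apply: le_trans (cmodD _ _) _; rewrite mulrDl lerD ?H1 ?H2.
Qed.

Lemma strong_derivativeM U f df g dg :
  strong_derivative U f df -> strong_derivative U g dg ->
  strong_derivative U (fun z => f z * g z) (fun z => df z * g z + f z * dg z).
Proof.
move=> F G z0 Uz0.
have [d1 [B1 [d10 B10 H1]]] := strong_derivative_bounds F Uz0.
have [d2 [B2 [d20 B20 H2]]] := strong_derivative_bounds G Uz0.
exists (Num.min d1 d2), (3 * B1 * B2); split.
- by rewrite lt_min d10.
- by rewrite !mulr_gt0.
move=> x y; rewrite !lt_min => /andP[x1 x2] /andP[y1 y2].
(* The cross term, last in the sum, is of second order because [g] is Lipschitz; each of the three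
   terms costs [B1 * B2]. *)
have -> : f x * g x - f y * g y - (df y * g y + f y * dg y) * (x - y) =
  (f x - f y - df y * (x - y)) * g x
  + f y * (g x - g y - dg y * (x - y)) + df y * ((x - y) * (g x - g y)) by ring.
have [_ _ _ _ f3] := H1 _ _ x1 y1; have [f1 f2 _ _ _] := H1 _ _ y1 x1.
have [g1 _ g2 _ g3] := H2 _ _ x2 y2.
apply: le_trans (cmodD _ _) _.
have -> : 3 * B1 * B2 * cmod (x - y) ^+ 2 = B1 * cmod (x - y) ^+ 2 * B2 +
  B1 * (B2 * cmod (x - y) ^+ 2) + B1 * (cmod (x - y) * (B2 * cmod (x - y))).
  ring.
apply: le_trans (lerD (cmodD _ _) (lexx _)) _.
by rewrite !cmodM !lerD// !ler_pM// ?mulr_ge0 ?cmod_ge0.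
Qed.

Lemma strong_derivativeV U : ~ U 0 ->
  strong_derivative U (fun z => z^-1) (fun z => - (z^-1 ^+ 2)).
Proof.
move=> U0 z0 Uz0.
have z00 : 0 < cmod z0 by rewrite cmod_gt0; apply/eqP => z0E; rewrite z0E in Uz0.
pose d := cmod z0 / 2; have d0 : 0 < d by rewrite divr_gt0.
have far x : cmod (x - z0) < d -> d <= cmod x.
  move=> xd; have : cmod z0 <= cmod x + cmod (x - z0).
    by apply: le_trans (cmodB _ _); rewrite opprB addrC subrK.
  rewrite /d in xd *; lra.
exists d, (d ^- 3); split=> [||x y /far xd /far yd]; rewrite ?exprn_gt0 ?invr_gt0//.
  by rewrite exprn_gt0.
have x0 : x != 0 by rewrite -cmod_gt0 (lt_le_trans d0).
have y0 : y != 0 by rewrite -cmod_gt0 (lt_le_trans d0).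
(* The remainder is exactly (x - y)^2 / (x y^2), and both moduli are at least [d], whence the
   constant [d ^- 3]. *)
have -> : x^-1 - y^-1 - - y^-1 ^+ 2 * (x - y) = x^-1 * y^-1 ^+ 2 * (x - y) ^+ 2.
  by field; rewrite x0 y0.
rewrite !expr2 !cmodM !cmodV ler_wpM2r ?mulr_ge0 ?cmod_ge0//.
rewrite -exprVn exprS expr2.
have inv_le w : d <= cmod w -> (cmod w)^-1 <= d^-1.
  by move=> dw; rewrite lef_pV2// posrE (lt_le_trans d0).
by rewrite !ler_pM ?mulr_ge0 ?invr_ge0 ?cmod_ge0 ?inv_le.
Qed.

Lemma strong_derivative_continuous U f df z0 : strong_derivative U f df ->
  U z0 -> f @ z0 --> f z0.
Proof.
move=> fdf Uz0; have [d [B [d0 B0 H]]] := strong_derivative_bounds fdf Uz0.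
apply/cvg_at_cmodP => e e0.
exists (Num.min d (e / B)) => [|x]; first by rewrite lt_min d0 divr_gt0.
rewrite lt_min => /andP[xd xe].
have z0d : cmod (z0 - z0) < d by rewrite subrr cmod0.
have [_ _ h _ _] := H _ _ xd z0d.
by apply: le_lt_trans h _; rewrite mulrC -ltr_pdivlMr.
Qed.

Lemma strong_derivative_derivative_continuous U f df z0 :
  strong_derivative U f df -> U z0 -> df @ z0 --> df z0.
Proof.
move=> fdf Uz0; have [d [B [d0 B0 H]]] := strong_derivative_bounds fdf Uz0.
apply/cvg_at_cmodP => e e0.
exists (Num.min d (e / B)) => [|x]; first by rewrite lt_min d0 divr_gt0.
rewrite lt_min => /andP[xd xe].
have z0d : cmod (z0 - z0) < d by rewrite subrr cmod0.
have [_ _ _ h _] := H _ _ xd z0d.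
by apply: le_lt_trans h _; rewrite mulrC -ltr_pdivlMr.
Qed.

Lemma strong_derivative_derive1 U f df z : strong_derivative U f df -> U z ->
  (f^`() z)%classic = df z.
Proof.
move=> fdf Uz; have [d [B [d0 B0 H]]] := fdf _ Uz.
apply: cvg_lim; first exact: norm_hausdorff.
apply: (cvg_cmodP _ _).2 => e e0; near=> h.
have h0 : h != 0 by near: h; exact: nbhs_dnbhs_neq.
have hB : cmod (h - 0) < Num.min d (e / B).
  near: h; apply: (@nbhs_dnbhs R[i]); apply/nbhs_cmodP.
  by exists (Num.min d (e / B)) => //; rewrite lt_min d0 divr_gt0.
move: hB; rewrite subr0 lt_min => /andP[hd he].
have hp : 0 < cmod h by rewrite cmod_gt0.
rewrite -(ltr_pM2l hp) -cmodM.
have -> : h * (h^-1 *: (f (h + z) - f z) - df z) =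
    f (h + z) - f z - df z * (h + z - z).
  by rewrite /GRing.scale /=; field.
apply: le_lt_trans (H _ _ _ _) _; rewrite ?subrr ?cmod0 ?addrK//.
rewrite expr2 mulrCA ltr_pM2l//.
by rewrite mulrC -ltr_pdivlMr.
Unshelve. all: by end_near. Qed.

Lemma eq_strong_derivative U f g df : open U ->
  (forall z, U z -> f z = g z) -> strong_derivative U f df ->
  strong_derivative U g df.
Proof.
move=> oU fg fdf z0 Uz0; have [d [B [d0 B0 H]]] := fdf _ Uz0.
have /nbhs_cmodP[d' d'0 sub] : nbhs z0 U by exact: open_nbhs_nbhs.
exists (Num.min d d'), B; split=> //; first by rewrite lt_min d0.
move=> x y; rewrite !lt_min => /andP[x1 x2] /andP[y1 y2].
by rewrite -!fg ?H//; exact: sub.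
Qed.

Lemma disk_open (r : R) : open (disk r : set R[i]).
Proof.
rewrite openE => z zr; apply/nbhs_cmodP.
exists (r - cmod z) => [|x xz]; first by rewrite subr_gt0.
have := cmodD (x - z) z; rewrite subrK /disk/=; lra.
Qed.

(** The successive derivatives are existentially quantified, so that closure under sums and products
    needs no formula for higher derivatives. *)
Fixpoint smooth U n f : Prop :=
  if n is n'.+1 then exists2 df, strong_derivative U f df & smooth U n' df
  else True.

Lemma smoothW U n f : smooth U n.+1 f -> smooth U n f.
Proof. by elim: n f => [//|n IH] f [df fdf /IH]; exists df. Qed.

Lemma smooth_cst U n c : smooth U n (fun=> c).
Proof.
elim: n c => [//|n IH] c; exists (fun=> 0) => //.
exact: strong_derivative_cst.
Qed.

Lemma smoothD U n f g : smooth U n f -> smooth U n g ->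
  smooth U n (fun z => f z + g z).
Proof.
elim: n f g => [//|n IH] f g [df fdf sf] [dg gdg sg].
by eexists; [exact: strong_derivativeD fdf gdg|exact: IH].
Qed.

Lemma smoothM U n f g : smooth U n f -> smooth U n g ->
  smooth U n (fun z => f z * g z).
Proof.
elim: n f g => [//|n IH] f g sf sg.
have [df fdf sdf] := sf; have [dg gdg sdg] := sg.
eexists; first exact: strong_derivativeM fdf gdg.
by apply: smoothD; apply: IH => //; exact: smoothW.
Qed.

Lemma smoothX U n f k : smooth U n f -> smooth U n (fun z => f z ^+ k).
Proof.
move=> sf; elim: k => [|k IH].
  by under eq_fun do rewrite expr0; exact: smooth_cst.
by under eq_fun do rewrite exprS; exact: smoothM.
Qed.

Lemma smooth_prod U n (I : Type) (s : seq I) (F : I -> R[i] -> R[i]) :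
  (forall i, smooth U n (F i)) -> smooth U n (fun z => \prod_(i <- s) F i z).
Proof.
move=> sF; elim: s => [|i s IH].
  by under eq_fun do rewrite big_nil; exact: smooth_cst.
by under eq_fun do rewrite big_cons; exact: smoothM.
Qed.

End StrongDerivative.

(** * Power series *)

Section PowerSeries.
Context {R : realType}.
Implicit Types (u v w x y z : R[i]) (f : R[i] -> R[i]) (U : set R[i])
  (a c : nat -> R[i]).

Lemma cvg_seq_cmodP (s : nat -> R[i]) l :
  s @ \oo --> l <-> forall e : R, 0 < e -> exists n0, forall n, (n0 <= n)%N ->
    cmod (s n - l) < e.
Proof.
split=> [sl e e0|h].
  have [n0 _ H] := (@cvg_cmodP _ _ _ _ s l).1 sl _ e0.
  by exists n0 => n n0n; exact: H.
apply: (@cvg_cmodP _ _ _ _ s l).2 => e /h[n0 H].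
by exists n0 => // n /= n0n; exact: H.
Qed.

Lemma cmod_lim_le (s : nat -> R[i]) l (C : R) :
  s @ \oo --> l -> (forall n, cmod (s n) <= C) -> cmod l <= C.
Proof.
move=> /cvg_seq_cmodP sl sC; apply/ler_addgt0Pr => e /sl[n0 /(_ n0 (leqnn _))].
rewrite cmodBC => h; rewrite -(subrK (s n0) l) addrC.
by apply: le_trans (cmodD _ _) _; apply: lerD => //; exact: ltW.
Qed.

(** The limit is assembled from the real and imaginary parts, two real series dominated by the same
    geometric one. *)
Lemma geometric_bound_cvg c (M q : R) : 0 <= q < 1 ->
  (forall k, cmod (c k) <= M * q ^+ k) -> exists l : R[i], series c @ \oo --> l.
Proof.
move=> /andP[q0 q1] cM.
have cvgc (p : R[i] -> R) : (forall z, `|p z| <= cmod z) ->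
    cvgn (series (fun k => p (c k))).
  move=> pn; apply: normed_cvg; apply: (@series_le_cvg _ _ (geometric M q)).
  - by move=> n; exact: normr_ge0.
  - by move=> n; rewrite (le_trans _ (cM n))// cmod_ge0.
  - by move=> n; exact: le_trans (pn _) (cM n).
  - by apply: is_cvg_geometric_series; rewrite ger0_norm.
have /cvgrPdist_lt hRe := cvgc _ (@normRe_le R).
have /cvgrPdist_lt hIm := cvgc _ (@normIm_le R).
set lRe := lim _ in hRe; set lIm := lim _ in hIm.
exists (lRe +i* lIm); apply/cvg_seq_cmodP => e e0.
have e20 : 0 < e / 2 by rewrite divr_gt0.
have [n1 _ H1] := hRe _ e20; have [n2 _ H2] := hIm _ e20.
exists (maxn n1 n2) => n; rewrite geq_max => /andP[n1n n2n].
apply: le_lt_trans (cmod_le _) _; rewrite !raddfB /= !raddf_sum /=.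
have := H1 _ n1n; have := H2 _ n2n; rewrite /= ![`|_ - series _ _|]distrC.
by rewrite /series /=; lra.
Qed.

(** Induction on k: the remainder of order k + 1 is u times that of order k plus k v^(k-1) (u -
    v)^2. The first term costs a factor [rho], the second at most 3 [rho] because k <= 4^k, which is
    why 4 appears. The factor [rho ^+ 2] on the left avoids exponents k - 2. *)
Lemma power_diff_bound u v (rho : R) k : 0 < rho ->
  cmod u <= rho -> cmod v <= rho ->
  rho ^+ 2 * cmod (u ^+ k - v ^+ k - (k%:R * v ^+ k.-1) * (u - v)) <=
  (4 * rho) ^+ k * cmod (u - v) ^+ 2.
Proof.
move=> rho0 ur vr; elim: k => [|k IH].
  by rewrite !expr0 mul0r mul0r subrr subr0 cmod0 mulr0 mul1r sqr_ge0.
have -> : u ^+ k.+1 - v ^+ k.+1 - k.+1%:R * v ^+ k.+1.-1 * (u - v) =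
    u * (u ^+ k - v ^+ k - k%:R * v ^+ k.-1 * (u - v))
    + k%:R * v ^+ k.-1 * (u - v) ^+ 2.
  case: k {IH} => [|k]; first by rewrite /= !expr1 !expr0; ring.
  by rewrite /= !exprS -!natr1; ring.
apply: le_trans (ler_wpM2l (sqr_ge0 _) (cmodD _ _)) _.
rewrite mulrDr; have -> : (4 * rho) ^+ k.+1 * cmod (u - v) ^+ 2 =
  rho * ((4 * rho) ^+ k * cmod (u - v) ^+ 2)
  + 3 * rho * ((4 * rho) ^+ k * cmod (u - v) ^+ 2) by rewrite exprS; ring.
apply: lerD.
  rewrite cmodM mulrCA; apply: ler_pM => //; first exact: cmod_ge0.
  by rewrite mulr_ge0 ?sqr_ge0 ?cmod_ge0.
have [->|k0] := eqVneq k 0%N.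
  rewrite mul0r mul0r cmod0 mulr0.
  rewrite expr0 mul1r mulr_ge0 ?sqr_ge0//; lra.
rewrite cmodM cmodX [leLHS]mulrA [leRHS]mulrA ler_wpM2r ?sqr_ge0//.
rewrite cmodM cmod_nat cmodX.
apply: (@le_trans _ _ (rho ^+ 2 * (k%:R * rho ^+ k.-1))).
  by rewrite ler_wpM2l ?sqr_ge0// ler_wpM2l// lerXn2r// ?nnegrE ?cmod_ge0// ltW.
have -> : rho ^+ 2 * (k%:R * rho ^+ k.-1) = k%:R * (rho * rho ^+ k).
  by case: k k0 {IH} => //= k _; rewrite (exprS _ k); ring.
have k4 : (k%:R : R) <= 4 ^+ k.
  by rewrite -natrX ler_nat ltnW// ltn_expl.
have -> : 3 * rho * (4 * rho) ^+ k = 3 * 4 ^+ k * (rho * rho ^+ k).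
  by rewrite exprMn; ring.
rewrite ler_wpM2r//; first by rewrite mulr_ge0 ?exprn_ge0// ltW.
apply: le_trans k4 _; rewrite ler_peMl ?exprn_ge0//; lra.
Qed.

Lemma sum_half_le2 n : \sum_(k < n) (2^-1 : R) ^+ k <= 2.
Proof.
suff -> : \sum_(k < n) (2^-1 : R) ^+ k = 2 - 2 * 2^-1 ^+ n.
  by rewrite gerBl mulr_ge0 ?exprn_ge0.
elim: n => [|n IH]; first by rewrite big_ord0 expr0; ring.
by rewrite big_ord_recr /= IH exprS; field.
Qed.

Lemma power_series_strong_derivative f a z0 :
  (\forall z \near z0, series (fun k => a k * (z - z0) ^+ k) @ \oo --> f z) ->
  exists2 rho : R, 0 < rho & exists2 df,
    strong_derivative [set z | cmod (z - z0) < rho] f df &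
    forall z, cmod (z - z0) < rho ->
      series (fun k => k.+1%:R * a k.+1 * (z - z0) ^+ k) @ \oo --> df z.
Proof.
move=> /nbhs_cmodP[d d0 fa].
have [s s0 sd] : exists2 s : R, 0 < s & s < d by exists (d / 2); lra.
(* The series converges at [z0 + s], so from [n0] on each term is the difference of two partial sums
   within 1 of the limit; [M] adds this bound 2 to the finitely many earlier terms. *)
have [M M0 aM] : exists2 M : R, 0 < M & forall k, cmod (a k) * s ^+ k <= M.
  have : cmod (z0 + s%:C - z0) < d.
    by rewrite addrAC subrr add0r cmod_real gtr0_norm.
  move=> /fa; rewrite addrAC subrr add0r => /cvg_seq_cmodP /(_ 1 ltr01)[n0 H].
  exists (\sum_(k < n0) cmod (a k) * s ^+ k + 2).
    by rewrite ltr_wpDl// sumr_ge0// => i _; rewrite mulr_ge0 ?cmod_ge0// exprn_ge0// ltW.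
  move=> k; have [kn|nk] := ltnP k n0.
    rewrite (bigD1 (Ordinal kn)) //= -addrA lerDl addr_ge0// sumr_ge0// => i _.
    by rewrite mulr_ge0 ?cmod_ge0// exprn_ge0// ltW.
  rewrite -[leLHS]add0r lerD//.
    by rewrite sumr_ge0// => i _; rewrite mulr_ge0 ?cmod_ge0// exprn_ge0// ltW.
  have -> : cmod (a k) * s ^+ k = cmod (a k * s%:C ^+ k).
    by rewrite cmodM cmodX cmod_real gtr0_norm.
  have h1 := H _ nk; have h2 := H _ (leqW nk).
  set S := series _ in h1 h2; set l := f _ in h1 h2.
  have -> : a k * s%:C ^+ k = (S k.+1 - l) - (S k - l).
    by rewrite /S seriesSr; ring.
  by apply: le_trans (cmodB _ _) _; lra.
(* With this choice 4 [rho] = s / 2, so [power_diff_bound] turns the remainders into a geometric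
   series of ratio 1/2. *)
pose rho := s / 8; have rho0 : 0 < rho by rewrite divr_gt0.
have rhod : rho < d by rewrite /rho; lra.
pose c z k := k.+1%:R * a k.+1 * (z - z0) ^+ k.
(* The condition on z is placed under the existential so that [choice] yields a total function; 0 is
   the default value outside the disk. *)
have cvgc z : exists l : R[i], cmod (z - z0) < rho -> series (c z) @ \oo --> l.
  have [zr|] := ltP (cmod (z - z0)) rho; last by exists 0.
  have [||l cl] := @geometric_bound_cvg (c z) (M / s) (4^-1); last by exists l.
    by rewrite invr_ge0 ler0n/= invf_lt1// ltr1n.
  move=> k; rewrite /c !cmodM cmod_nat cmodX.
  apply: (@le_trans _ _ (k.+1%:R * (M / s ^+ k.+1) * rho ^+ k)).
    rewrite !ler_pM ?mulr_ge0 ?exprn_ge0 ?cmod_ge0//.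
      by rewrite ler_pdivlMr ?exprn_gt0.
    by rewrite lerXn2r ?nnegrE ?cmod_ge0// ltW.
  have -> : k.+1%:R * (M / s ^+ k.+1) * rho ^+ k = M / s * (k.+1%:R * 8^-1 ^+ k).
    rewrite /rho exprMn (exprS s); move: (_^-1 ^+ k) (s ^+ k) (exprn_gt0 k s0).
    by move=> A B B0; field; rewrite !gt_eqF.
  rewrite ler_wpM2l ?divr_ge0 ?(ltW M0) ?(ltW s0)//.
  have -> : (4^-1 : R) = 2 * 8^-1 by field.
  rewrite exprMn.
  rewrite ler_wpM2r ?exprn_ge0// -natrX ler_nat.
  by rewrite ltn_expl.
have [df dfP] := choice cvgc.
exists rho => //; exists df => //.
have main x y : cmod (x - z0) < rho -> cmod (y - z0) < rho ->
    cmod (f x - f y - df y * (x - y)) <= 2 * M / rho ^+ 2 * cmod (x - y) ^+ 2.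
  move=> xr yr.
  pose S z := series (fun k => a k * (z - z0) ^+ k).
  (* The partial sums of [f] are shifted by one: n + 1 terms of the series match n terms of the
     derived series, the constant term contributing nothing to the latter. *)
  have Sf z : cmod (z - z0) < rho -> (fun n => S z n.+1) @ \oo --> f z.
    move=> zr; apply/cvg_seq_cmodP => e e0.
    have /cvg_seq_cmodP/(_ _ e0)[n0 H] := fa _ (lt_trans zr rhod).
    by exists n0 => n n0n; apply: H; exact: leqW.
  have cl : (fun n => S x n.+1 - S y n.+1 - series (c y) n * (x - y)) @ \oo -->
      f x - f y - df y * (x - y).
    apply: cvgB; first by apply: cvgB; exact: Sf.
    by apply: cvgM; [exact: dfP|exact: cvg_cst].
  apply: cmod_lim_le cl _ => n.
  have -> : S x n.+1 - S y n.+1 - series (c y) n * (x - y) = \sum_(k < n.+1)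
     a k * ((x - z0) ^+ k - (y - z0) ^+ k - (k%:R * (y - z0) ^+ k.-1) * ((x - z0) - (y - z0))).
    have -> : series (c y) n = \sum_(k < n.+1) a k * (k%:R * (y - z0) ^+ k.-1).
      rewrite big_ord_recl /= mul0r mulr0 add0r /series /= big_mkord.
      by apply: eq_bigr => k _; rewrite /c /bump /=; ring.
    rewrite /S /series /= !big_mkord mulr_suml -!sumrB.
    by apply: eq_bigr => k _; ring.
  apply: le_trans (cmod_sum _ _ _) _.
  apply: (@le_trans _ _ (\sum_(k < n.+1) 2^-1 ^+ k * (M / rho ^+ 2 * cmod (x - y) ^+ 2))).
    apply: ler_sum => k _; rewrite cmodM.
    have := power_diff_bound k rho0 (ltW xr) (ltW yr).
    have -> : x - z0 - (y - z0) = x - y by ring.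
    set E := cmod (_ - _ - _); rewrite mulrC -ler_pdivlMr ?exprn_gt0// => hE.
    apply: le_trans (ler_wpM2l (cmod_ge0 _) hE) _.
    have -> : cmod (a k) * ((4 * rho) ^+ k * cmod (x - y) ^+ 2 / rho ^+ 2) =
      cmod (a k) * s ^+ k * (2^-1 ^+ k * (cmod (x - y) ^+ 2 / rho ^+ 2)).
      have -> : 4 * rho = s * 2^-1 by rewrite /rho; field.
      by rewrite exprMn; ring.
    have -> : 2^-1 ^+ k * (M / rho ^+ 2 * cmod (x - y) ^+ 2) =
      M * (2^-1 ^+ k * (cmod (x - y) ^+ 2 / rho ^+ 2)) by ring.
    by rewrite ler_wpM2r// mulr_ge0 ?exprn_ge0 ?divr_ge0 ?sqr_ge0.
  rewrite -mulr_suml.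
  have -> : 2 * M / rho ^+ 2 * cmod (x - y) ^+ 2 =
    2 * (M / rho ^+ 2 * cmod (x - y) ^+ 2) by ring.
  rewrite ler_wpM2r ?sum_half_le2// mulr_ge0 ?sqr_ge0//.
  by rewrite divr_ge0 ?ltW ?exprn_gt0.
move=> w /= wr; exists (rho - cmod (w - z0)), (2 * M / rho ^+ 2); split.
- by rewrite subr_gt0.
- by rewrite !divr_gt0 ?mulr_gt0 ?exprn_gt0.
- move=> x y xw yw; apply: main.
    by have := cmodD (x - w) (w - z0); rewrite addrA subrK; lra.
  by have := cmodD (y - w) (w - z0); rewrite addrA subrK; lra.
Qed.

(** The derived series provides the derivative on a whole disk around each point and at the same
    time exhibits it as analytic, so the statement can be iterated. *)
Lemma analytic_strong_derivative U f : analytic_on U f ->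
  strong_derivative U f (f^`())%classic /\ analytic_on U (f^`())%classic.
Proof.
move=> fU; suff H z0 : U z0 -> exists2 rho : R, 0 < rho & exists2 a,
    strong_derivative [set z | cmod (z - z0) < rho] f (f^`())%classic &
    forall z, cmod (z - z0) < rho ->
      series (fun k => a k * (z - z0) ^+ k) @ \oo --> (f^`() z)%classic.
  split=> z0 /H[rho rho0 [a fdf cvga]].
    by apply: fdf; rewrite /= subrr cmod0.
  by exists a; apply/nbhs_cmodP; exists rho.
move=> /fU[a /power_series_strong_derivative[rho rho0 [df fdf dfa]]].
have dfE z : cmod (z - z0) < rho -> (f^`() z)%classic = df z.
  by move=> zr; exact: strong_derivative_derive1 fdf zr.
exists rho => //; exists (fun k => k.+1%:R * a k.+1) => [z zr|z zr]; last first.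
  by rewrite dfE//; exact: dfa.
have [d [B [d0 B0 H]]] := fdf z zr.
exists (Num.min d (rho - cmod (z - z0))), B; split=> //.
  by rewrite lt_min d0 subr_gt0.
move=> x y; rewrite !lt_min => /andP[xd _] /andP[yd yr]; rewrite dfE ?H//.
by have := cmodD (y - z) (z - z0); rewrite addrA subrK; lra.
Qed.

Lemma analytic_smooth U f n : analytic_on U f -> smooth U n f.
Proof.
elim: n f => [//|n IH] f /analytic_strong_derivative[fdf dfU].
by exists (f^`())%classic => //; exact: IH.
Qed.

End PowerSeries.

(** * Integrals along curves *)

Section CurveDerivative.
Context {R : realType}.
Implicit Types (g k dk : R -> R[i]) (s t : R).

Lemma is_derive_epsP (F : R -> R) t l : is_derive t 1 F l <->
  forall e : R, 0 < e -> exists2 d : R, 0 < d &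
    forall h, `|h| < d -> `|F (t + h) - F t - h * l| <= e * `|h|.
Proof.
split=> [[Fd Fl] e e0|H].
- have : (fun h => h^-1 *: (F (h *: 1 + t) - F t)) @ 0^' --> l.
    by rewrite -Fl; exact: Fd.
  move=> /cvgrPdist_le /(_ _ e0).
  rewrite /dnbhs /within /= => /nbhs_ballP[d /= d0 sub]; exists d => // h hd.
  have [->|h0] := eqVneq h 0.
    by rewrite addr0 subrr mul0r subr0 normr0 mulr0.
  have : ball 0 d h by rewrite -ball_normE /= sub0r normrN.
  move=> /sub /(_ h0); rewrite distrC.
  have -> : h *: 1 + t = t + h by rewrite /GRing.scale /= mulr1 addrC.
  have hp : 0 < `|h| by rewrite normr_gt0.
  rewrite -(ler_pM2r hp) -normrM /GRing.scale /=.
  by rewrite mulrBl mulrAC mulVf// mul1r (mulrC l).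
- suff Hc : (fun h => h^-1 *: (F (h *: 1 + t) - F t)) @ 0^' --> l.
    by apply: DeriveDef; [apply/cvg_ex; exists l|exact: cvg_lim Hc].
  apply/cvgrPdist_le => e /H[d d0 Hd]; rewrite /dnbhs /within /=.
  apply/nbhs_ballP; exists d => //= h; rewrite -ball_normE /= sub0r normrN.
  move=> hd h0; have hp : 0 < `|h| by rewrite normr_gt0.
  have -> : h *: 1 + t = t + h by rewrite /GRing.scale /= mulr1 addrC.
  rewrite distrC -(ler_pM2r hp) -normrM /GRing.scale /=.
  by rewrite mulrBl mulrAC mulVf// mul1r (mulrC l); exact: Hd.
Qed.

(** The form without quotients covers h = 0 and composes directly with the remainder of
    [strong_derivative]; [curve_derivativeP] identifies it with componentwise differentiability. *)
Definition curve_derivative g t (l : R[i]) : Prop :=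
  forall e : R, 0 < e -> exists2 d : R, 0 < d &
    forall h, `|h| < d -> cmod (g (t + h) - g t - h%:C * l) <= e * `|h|.

Lemma curve_derivativeP g t l : curve_derivative g t l <->
  is_derive t 1 (fun t => complex.Re (g t)) (complex.Re l) /\
  is_derive t 1 (fun t => complex.Im (g t)) (complex.Im l).
Proof.
have ReE h : complex.Re (h%:C * l) = h * complex.Re l.
  by case: l => a b /=; rewrite mul0r subr0.
have ImE h : complex.Im (h%:C * l) = h * complex.Im l.
  by case: l {ReE} => a b /=; rewrite mul0r addr0.
split=> [H|[/is_derive_epsP H1 /is_derive_epsP H2] e e0].
  split; apply/is_derive_epsP => e /H[d d0 Hd]; exists d => // h /Hd.
    by apply: le_trans; rewrite -ReE -!raddfB; exact: normRe_le.
  by apply: le_trans; rewrite -ImE -!raddfB; exact: normIm_le.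
have e20 : 0 < e / 2 by rewrite divr_gt0.
have [d1 d10 Hd1] := H1 _ e20; have [d2 d20 Hd2] := H2 _ e20.
exists (Num.min d1 d2) => [|h]; first by rewrite lt_min d10.
rewrite lt_min => /andP[/Hd1 h1 /Hd2 h2].
apply: le_trans (cmod_le _) _; rewrite !raddfB /= ReE ImE.
have -> : e * `|h| = e / 2 * `|h| + e / 2 * `|h| by field.
exact: lerD.
Qed.

Lemma curve_derivative_comp U (f df : R[i] -> R[i]) g t l :
  strong_derivative U f df -> U (g t) -> curve_derivative g t l ->
  curve_derivative (f \o g) t (df (g t) * l).
Proof.
move=> fdf Ugt gl e e0.
have [d [B [d0 B0 H]]] := fdf _ Ugt.
pose A := cmod (df (g t)); have A0 : 0 <= A := cmod_ge0 _.
pose L := cmod l + 1; have L0 : 0 < L by rewrite /L; have := cmod_ge0 l; lra.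
have [d1 d10 H1] := gl 1 ltr01.
(* Half of [e] pays for the error of the curve, multiplied by [A], and half for the quadratic
   remainder of [f], at most [B * (L * |h|)^2]. Adding 1 to [A] keeps the division legitimate when
   the derivative vanishes. *)
pose e1 := e / 2 / (A + 1); have e10 : 0 < e1 by rewrite !divr_gt0//; lra.
have [d2 d20 H2] := gl _ e10.
have d3 : 0 < d / L by rewrite divr_gt0.
have d4 : 0 < e / 2 / (B * L ^+ 2) by rewrite !divr_gt0 ?mulr_gt0 ?exprn_gt0.
exists (Num.min (Num.min d1 d2) (Num.min (d / L) (e / 2 / (B * L ^+ 2)))) => [|h].
  by rewrite !lt_min d10 d20 d3.
rewrite !lt_min => /andP[/andP[/H1 h1 /H2 h2] /andP[h3 h4]].
have hL : cmod (g (t + h) - g t) <= L * `|h|.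
  rewrite -(subrK (h%:C * l) (g (t + h) - g t)); apply: le_trans (cmodD _ _) _.
  rewrite /L mulrDl addrC cmodM cmod_real mulrC.
  by apply: lerD.
have hd : cmod (g (t + h) - g t) < d.
  by apply: le_lt_trans hL _; rewrite mulrC -ltr_pdivlMr.
have gd : cmod (g t - g t) < d by rewrite subrr cmod0.
have hf := H _ _ hd gd; rewrite /=.
have -> : f (g (t + h)) - f (g t) - h%:C * (df (g t) * l) =
  (f (g (t + h)) - f (g t) - df (g t) * (g (t + h) - g t))
  + df (g t) * (g (t + h) - g t - h%:C * l) by ring.
apply: le_trans (cmodD _ _) _.
have -> : e * `|h| = e / 2 * `|h| + e / 2 * `|h| by field.
apply: lerD.
- apply: le_trans hf _.
  apply: (@le_trans _ _ (B * (L * `|h|) ^+ 2)).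
    by rewrite ler_wpM2l ?(ltW B0)// lerXn2r ?nnegrE ?cmod_ge0// mulr_ge0 // ltW.
  rewrite exprMn expr2 mulrA [`|h| ^+ 2]expr2 mulrA ler_wpM2r//.
  rewrite -expr2 mulrC -ler_pdivlMr ?mulr_gt0 ?exprn_gt0//.
  exact: ltW.
- rewrite cmodM -/A; apply: (@le_trans _ _ (A * (e1 * `|h|))).
    by rewrite ler_wpM2l.
  rewrite mulrA ler_wpM2r// /e1 mulrCA ger_pMr ?divr_gt0//.
  by rewrite ler_pdivrMr ?mul1r; lra.
Qed.

End CurveDerivative.

(** * Integrals of complex-valued functions over a segment *)

Section ComplexIntegral.
Context {R : realType}.
Implicit Types (g k : R -> R[i]) (a b t : R).
Local Notation mu := (@lebesgue_measure R).

Lemma continuous_Re g : continuous g -> continuous (fun t => complex.Re (g t)).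
Proof.
move=> cg t; apply/cvgrPdist_lt => e e0.
have H := (@cvg_cmodP _ _ (nbhs t) _ g (g t)).1 (cg t) _ e0.
near=> x; rewrite distrC -raddfB; apply: le_lt_trans (normRe_le _) _.
by near: x; exact: H.
Unshelve. all: by end_near. Qed.

Lemma continuous_Im g : continuous g -> continuous (fun t => complex.Im (g t)).
Proof.
move=> cg t; apply/cvgrPdist_lt => e e0.
have H := (@cvg_cmodP _ _ (nbhs t) _ g (g t)).1 (cg t) _ e0.
near=> x; rewrite distrC -raddfB; apply: le_lt_trans (normIm_le _) _.
by near: x; exact: H.
Unshelve. all: by end_near. Qed.

Lemma continuous_ReIm g : continuous (fun t => complex.Re (g t)) ->
  continuous (fun t => complex.Im (g t)) -> continuous g.
Proof.
move=> cRe cIm t; apply: (@cvg_cmodP _ _ (nbhs t) _ g (g t)).2 => e e0.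
have e20 : 0 < e / 2 by rewrite divr_gt0.
have /cvgrPdist_lt/(_ _ e20) H1 := cRe t.
have /cvgrPdist_lt/(_ _ e20) H2 := cIm t.
near=> x; rewrite cmodBC; apply: le_lt_trans (cmod_le _) _.
rewrite !raddfB /= [e]splitr ltrD//; [near: x; exact: H1|near: x; exact: H2].
Unshelve. all: by end_near. Qed.

Lemma continuous_segment_integrable (f : R -> R) a b : continuous f ->
  mu.-integrable `[a, b] (EFin \o f).
Proof.
move=> cf; apply: continuous_compact_integrable; first exact: segment_compact.
exact: continuous_subspaceT.
Qed.

Lemma cintegralD a b g k : continuous g -> continuous k ->
  cintegral a b (fun t => g t + k t) = cintegral a b g + cintegral a b k.
Proof.
move=> cg ck; have cRg := continuous_Re cg; have cRk := continuous_Re ck.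
have cIg := continuous_Im cg; have cIk := continuous_Im ck.
rewrite /cintegral.
under eq_Rintegral do rewrite raddfD.
under [in X in _ +i* X]eq_Rintegral do rewrite raddfD.
by rewrite !RintegralD//; exact: continuous_segment_integrable.
Qed.

Lemma cintegralZ a b (c : R[i]) g : continuous g ->
  cintegral a b (fun t => c * g t) = c * cintegral a b g.
Proof.
move=> cg; have cR := continuous_Re cg; have cI := continuous_Im cg.
have ReE t : complex.Re (c * g t) =
    complex.Re c * complex.Re (g t) - complex.Im c * complex.Im (g t).
  by case: c (g t) => x y [].
have ImE t : complex.Im (c * g t) =
    complex.Re c * complex.Im (g t) + complex.Im c * complex.Re (g t).
  by case: c {ReE} (g t) => x y [u v] /=; rewrite addrC.
rewrite /cintegral.
under eq_Rintegral do rewrite ReE.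
under [in X in _ +i* X]eq_Rintegral do rewrite ImE.
have i1 := continuous_segment_integrable a b cR.
have i2 := continuous_segment_integrable a b cI.
have cM (x : R) (f : R -> R) : continuous f -> continuous (fun t => x * f t).
  by move=> cf t; apply: cvgM; [exact: cvg_cst|exact: cf].
rewrite RintegralB ?RintegralD ?RintegralZl//;
  do ?[exact: continuous_segment_integrable (cM _ _ _)].
by case: c ReE ImE => x y _ _ /=; simpc.
Qed.

Lemma eq_cintegral a b g k : (forall t, a <= t <= b -> g t = k t) ->
  cintegral a b g = cintegral a b k.
Proof.
move=> gk; congr (_ +i* _); apply: eq_Rintegral => t;
  by rewrite inE /= in_itv /= => /gk ->.
Qed.

Lemma cintegral_cst a b (c : R[i]) : a <= b ->
  cintegral a b (fun=> c) = (b - a)%:C * c.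
Proof.
move=> ab; rewrite /cintegral !Rintegral_cst//= !lebesgue_measure_itv/=.
rewrite lte_fin; case: ltP => [ab'|ba] /=.
  by case: c => x y; simpc; rewrite ![_ * (b - a)]mulrC.
have -> : b = a by apply/le_anti/andP.
by rewrite subrr; case: c => x y; simpc.
Qed.

(** The factor 2 comes from bounding the real and imaginary parts separately; it only affects
    implied constants. *)
Lemma cmod_cintegral_le a b (C : R) g : a <= b -> continuous g ->
  (forall t, a <= t <= b -> cmod (g t) <= C) ->
  cmod (cintegral a b g) <= 2 * C * (b - a).
Proof.
move=> ab cg gC.
have bound (f : R -> R) : continuous f -> (forall t, `|f t| <= cmod (g t)) ->
    `|\int[mu]_(t in `[a, b]) f t| <= C * (b - a).
  move=> cf fg; apply: le_trans.
    by apply: le_normr_Rintegral => //; exact: continuous_segment_integrable.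
  have <- : \int[mu]_(t in `[a, b]) C = C * (b - a).
    rewrite Rintegral_cst//= lebesgue_measure_itv/= lte_fin.
    case: ltP => //= ba.
    by have -> : b = a by [apply/le_anti/andP]; rewrite subrr.
  apply: le_Rintegral => //.
  - apply: continuous_segment_integrable => t.
    by apply: cvg_norm; exact: cf.
  - apply: continuous_segment_integrable => t; exact: cvg_cst.
  - by move=> t /=; rewrite in_itv /= => /gC; apply: le_trans.
apply: le_trans (cmod_le _) _; rewrite /=.
have -> : 2 * C * (b - a) = C * (b - a) + C * (b - a) by ring.
apply: lerD; apply: bound.
- exact: continuous_Re.
- by move=> t; exact: normRe_le.
- exact: continuous_Im.
- by move=> t; exact: normIm_le.
Qed.

Lemma cintegral_split a c b g : a <= c <= b -> continuous g ->
  cintegral a b g = cintegral a c g + cintegral c b g.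
Proof.
move=> /andP[ac cb] cg.
have split f : continuous f -> \int[mu]_(t in `[a, b]) f t =
    \int[mu]_(t in `[a, c]) f t + \int[mu]_(t in `[c, b]) f t.
  move=> cf; apply/eqP; rewrite addrC -subr_eq; apply/eqP.
  rewrite Rintegral_itvB ?bnd_simp//; last exact: continuous_segment_integrable.
  apply: Rintegral_itv_obnd_cbnd; apply: integrableS (continuous_segment_integrable c b cf) => //.
  by move=> x /=; rewrite !in_itv/= => /andP[/ltW -> ->].
rewrite /cintegral (split _ (continuous_Re cg)) (split _ (continuous_Im cg)).
by [].
Qed.

Lemma cintegral_FTC a b g dg : a < b -> continuous dg ->
  (forall t, curve_derivative g t (dg t)) -> cintegral a b dg = g b - g a.
Proof.
move=> ab cdg gdg.
have real (f df : R -> R) : continuous df -> (forall t, is_derive t 1 f (df t)) ->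
    \int[mu]_(t in `[a, b]) df t = f b - f a.
  move=> cdf fdf.
  have cf t : {for t, continuous f}.
    by apply/differentiable_continuous; rewrite -derivable1_diffP; have [] := fdf t.
  rewrite /Rintegral (@continuous_FTC2 _ _ f)//.
  - exact: continuous_subspaceT.
  - split=> [t _||]; first by have [] := fdf t.
    + by apply: cvg_at_right_filter; exact: cf.
    + by apply: cvg_at_left_filter; exact: cf.
  - by move=> t _; rewrite derive1E; have [_ ->] := fdf t.
have dRe t := ((curve_derivativeP g t (dg t)).1 (gdg t)).1.
have dIm t := ((curve_derivativeP g t (dg t)).1 (gdg t)).2.
rewrite /cintegral (real _ _ (continuous_Re cdg) dRe).
rewrite (real _ _ (continuous_Im cdg) dIm).
by case: (g a) (g b) => x y [].
Qed.

End ComplexIntegral.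

(** * Cauchy's formula *)

Local Notation cis t := (cexp (0 +i* t)).

Section Circle.
Context {R : realType}.
Implicit Types (z w : R[i]) (s t : R) (f df g h : R[i] -> R[i]) (U : set R[i]).

Lemma cisE t : cis t = cos t +i* sin t.
Proof. by rewrite /cexp /= expR0 mul1r. Qed.

Lemma cmod_cis t : cmod (cis t) = 1.
Proof. by rewrite cisE /cmod /= cos2Dsin2 sqrtr1. Qed.

Lemma continuous_cis : continuous (fun t => cis t).
Proof.
apply: continuous_ReIm.
- by under eq_fun do rewrite cisE; exact: continuous_cos.
- by under eq_fun do rewrite cisE; exact: continuous_sin.
Qed.

Lemma continuous_mulc (g h : R -> R[i]) : continuous g -> continuous h ->
  continuous (fun t => g t * h t).
Proof. by move=> cg ch t; apply: cvgM; [exact: cg|exact: ch]. Qed.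

Lemma continuous_mulcl (c : R[i]) (g : R -> R[i]) : continuous g ->
  continuous (fun t => c * g t).
Proof. by move=> cg t; apply: cvgM; [exact: cvg_cst|exact: cg]. Qed.

Lemma continuous_circle z : continuous (fun t => z * cis t).
Proof. exact: continuous_mulcl continuous_cis. Qed.

Lemma curve_derivative_circle z t :
  curve_derivative (fun t => z * cis t) t ('i * (z * cis t)).
Proof.
have dcis : curve_derivative (fun t => cis t) t ('i * cis t).
  have -> : (fun t => cis t) = (fun t => cos t +i* sin t).
    by apply/funext => x; exact: cisE.
  apply/curve_derivativeP; rewrite cisE /= !mul0r !mul1r sub0r add0r.
  by split; [exact: is_derive_cos|exact: is_derive_sin].
have zU : strong_derivative setT (fun w => z * w) (fun=> z).
  have := strong_derivativeM (@strong_derivative_cst R setT z) (@strong_derivative_id R setT).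
  by under [X in strong_derivative _ _ X -> _]eq_fun do rewrite mul0r add0r mulr1.
by rewrite mulrCA; exact: (curve_derivative_comp zU).
Qed.

Lemma cis_pi : cis pi = -1 :> R[i].
Proof. by rewrite cisE cospi sinpi; simpc. Qed.

Lemma cis_Npi : cis (- pi) = -1 :> R[i].
Proof. by rewrite cisE cosN sinN cospi sinpi; simpc. Qed.

Lemma continuous_circle_comp U f df z : strong_derivative U f df ->
  (forall t, U (z * cis t)) -> continuous (fun t => f (z * cis t)).
Proof.
move=> fdf Uz t; apply: (@cvg_comp _ _ _ (fun t => z * cis t) f).
  exact: continuous_circle.
exact: strong_derivative_continuous fdf (Uz t).
Qed.

Lemma continuous_circle_derivative U f df z : strong_derivative U f df ->
  (forall t, U (z * cis t)) -> continuous (fun t => df (z * cis t)).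
Proof.
move=> fdf Uz t; apply: (@cvg_comp _ _ _ (fun t => z * cis t) df).
  exact: continuous_circle.
exact: strong_derivative_derivative_continuous fdf (Uz t).
Qed.

Lemma NpiLpi : - pi < pi :> R.
Proof. by have := pi_gt0 R; lra. Qed.

Lemma cintegral_circle_derivative U f df z : strong_derivative U f df ->
  (forall t, U (z * cis t)) ->
  cintegral (- pi) pi (fun t => z * cis t * df (z * cis t)) = 0.
Proof.
move=> fdf Uz.
have cdf := continuous_mulc (@continuous_circle z) (continuous_circle_derivative fdf Uz).
have i0 : 'i%C != 0 :> R[i] by rewrite -cmod_gt0 /cmod /= expr0n expr1n add0r sqrtr1.
apply: (mulfI i0); rewrite -(cintegralZ _ _ _ cdf) mulr0.
rewrite (cintegral_FTC (g := fun t => f (z * cis t)) NpiLpi).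
- by rewrite cis_pi cis_Npi subrr.
- exact: continuous_mulcl cdf.
- move=> t; have -> : 'i * (z * cis t * df (z * cis t)) =
    df (z * cis t) * ('i * (z * cis t)) by ring.
  exact: curve_derivative_comp fdf (Uz t) (curve_derivative_circle z t).
Qed.

(** * The mean value property on circles centred at 0 *)

Section MeanValue.
Variables (r : R) (f df : R[i] -> R[i]) (z : R[i]).
Hypothesis fdf : strong_derivative (disk r) f df.

Let J s := cintegral (- pi) pi (fun t => f (s%:C * z * cis t)).
(** The factor in front is z and not s z, so that this is the derivative of [J] at s = 0 as well. *)
Let D s := cintegral (- pi) pi (fun t => z * cis t * df (s%:C * z * cis t)).

Let on_circle w t : disk r w -> disk r (w * cis t).
Proof. by rewrite /disk /= cmodM cmod_cis mulr1. Qed.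

(** Differentiation under the integral needs a remainder uniform in t, which compactness of the
    segment gives. The same [e] bounds the increment x and, through its inverse, the constant of the
    quadratic remainder, so one parameter tending to 0 suffices. *)
Let uniform_remainder s : disk r (s%:C * z) -> exists2 e : R, 0 < e &
  forall t x, - pi <= t <= pi -> `|x| < e ->
    e * cmod (f ((s + x)%:C * z * cis t) - f (s%:C * z * cis t)
              - x%:C * (z * cis t * df (s%:C * z * cis t))) <= `|x| ^+ 2.
Proof.
move=> sr; pose P (e : R) (t : R) := forall x, `|x| < e ->
  e * cmod (f ((s + x)%:C * z * cis t) - f (s%:C * z * cis t)
            - x%:C * (z * cis t * df (s%:C * z * cis t))) <= `|x| ^+ 2.
have cov t : `[(- pi), pi]%classic t ->
    \forall t' \near t & e \near 0^'+, P e t'.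
  move=> _; have [d [B [d0 B0 H]]] := fdf (on_circle t sr).
  (* [K] dominates both |z|, for the distance to the centre, and |z|^2, for the remainder. *)
  pose K := cmod z ^+ 2 + 1; have K0 : 0 < K by rewrite ltr_wpDl ?sqr_ge0.
  have d20 : 0 < d / 2 by rewrite divr_gt0.
  have zK : cmod z <= K.
    by rewrite /K; have := cmod_ge0 z; nra.
  have ct := (@cvg_cmodP _ _ (nbhs t) _ _ _).1 (@continuous_circle (s%:C * z) t) _ d20.
  near=> t' e => x xe.
  have e0 : 0 < e by near: e; exact: nbhs_right_gt.
  have eK : e < d / 2 / K by near: e; apply: nbhs_right_lt; rewrite divr_gt0.
  have eB : e < (B * K)^-1 by near: e; apply: nbhs_right_lt; rewrite invr_gt0 mulr_gt0.
  have h1 : cmod (s%:C * z * cis t' - s%:C * z * cis t) < d / 2 by near: t'; exact: ct.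
  have E : (s + x)%:C * z * cis t' - s%:C * z * cis t' = x%:C * (z * cis t').
    by rewrite rmorphD /=; ring.
  have cE : cmod (x%:C * (z * cis t')) = `|x| * cmod z.
    by rewrite cmodM (cmodM z) cmod_cis mulr1 cmod_real.
  have h2 : cmod ((s + x)%:C * z * cis t' - s%:C * z * cis t) < d.
    rewrite -(subrK (s%:C * z * cis t') ((s + x)%:C * z * cis t')) -addrA.
    apply: le_lt_trans (cmodD _ _) _; rewrite E cE [d]splitr ltrD//.
    apply: (@le_lt_trans _ _ (`|x| * K)); first by rewrite ler_wpM2l.
    by rewrite -ltr_pdivlMr//; exact: lt_trans xe eK.
  have h3 : cmod (s%:C * z * cis t' - s%:C * z * cis t) < d by lra.
  have := H _ _ h2 h3; rewrite E cE.
  have -> : x%:C * (z * cis t' * df (s%:C * z * cis t')) =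
    df (s%:C * z * cis t') * (x%:C * (z * cis t')) by ring.
  move=> hf; apply: le_trans (ler_wpM2l (ltW e0) hf) _.
  apply: (@le_trans _ _ (e * (B * (`|x| ^+ 2 * K)))).
    rewrite !ler_wpM2l ?(ltW e0) ?(ltW B0)// exprMn ler_wpM2l ?sqr_ge0//.
    by rewrite /K lerDl.
  have -> : e * (B * (`|x| ^+ 2 * K)) = e * (B * K) * `|x| ^+ 2 by ring.
  by rewrite ler_piMl ?sqr_ge0// -ler_pdivlMr ?mulr_gt0// mul1r ltW.
have /compact_near_coveringP := @segment_compact R (- pi) pi.
move=> /(_ _ _ _ (at_right_proper_filter 0) cov) near_e.
have [e [e0 eP]] : exists e : R, 0 < e /\ `[(- pi), pi]%classic `<=` P e.
  apply: (@filter_ex _ (0 : R)^'+).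
  by near=> e; split; [near: e; exact: nbhs_right_gt|near: e].
by exists e => // t x tpi; apply: eP; rewrite /= in_itv.
Unshelve. all: by end_near. Qed.

Let J_derivative s : disk r (s%:C * z) -> curve_derivative J s (D s).
Proof.
move=> sr eps eps0; have [e e0 He] := uniform_remainder sr.
have pi0 := pi_gt0 R.
(* The integral of the remainder is at most 2 (|x|^2 / e) 2 pi, which is below eps |x| once |x| <
   [c]. The last term of the minimum below keeps (s + x) z in the disk. *)
pose c := eps * e / (4 * pi).
have c0 : 0 < c by rewrite /c divr_gt0 ?mulr_gt0.
have K0 : 0 < (r - cmod (s%:C * z)) / (cmod z + 1).
  by rewrite divr_gt0 ?subr_gt0// ltr_wpDl ?cmod_ge0.
exists (Num.min (Num.min e c) ((r - cmod (s%:C * z)) / (cmod z + 1))) => [|x].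
  by rewrite !lt_min e0 c0.
rewrite !lt_min => /andP[/andP[xe xc] xK].
have sxr : disk r ((s + x)%:C * z).
  rewrite /disk /= rmorphD /= mulrDl; apply: le_lt_trans (cmodD _ _) _.
  rewrite -ltrBrDl cmodM cmod_real; apply: le_lt_trans (_ : `|x| * (cmod z + 1) < _).
    by rewrite ler_wpM2l// lerDl.
  by rewrite -ltr_pdivlMr ?ltr_wpDl ?cmod_ge0.
have c1 := continuous_circle_comp fdf (fun t => on_circle t sxr).
have c2 := continuous_circle_comp fdf (fun t => on_circle t sr).
have c3 := continuous_mulc (@continuous_circle z)
  (continuous_circle_derivative fdf (fun t => on_circle t sr)).
have cZ := continuous_mulcl.
have cD (g1 g2 : R -> R[i]) : continuous g1 -> continuous g2 ->
    continuous (fun t => g1 t + g2 t).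
  by move=> cg1 cg2 t; apply: cvgD; [exact: cg1|exact: cg2].
have -> : J (s + x) - J s - x%:C * D s = cintegral (- pi) pi (fun t =>
    f ((s + x)%:C * z * cis t) + -1 * f (s%:C * z * cis t)
    + - x%:C * (z * cis t * df (s%:C * z * cis t))).
  rewrite (cintegralD _ _ (cD _ _ c1 (cZ _ _ c2)) (cZ _ _ c3)).
  rewrite (cintegralD _ _ c1 (cZ _ _ c2)) (cintegralZ _ _ _ c2) (cintegralZ _ _ _ c3).
  by rewrite /J /D; ring.
apply: le_trans (cmod_cintegral_le (C := `|x| ^+ 2 / e) (ltW NpiLpi) _ _) _.
- exact: cD _ _ (cD _ _ c1 (cZ _ _ c2)) (cZ _ _ c3).
- move=> t tpi; rewrite ler_pdivlMr// mulrC mulN1r mulNr.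
  exact: He.
- have -> : 2 * (`|x| ^+ 2 / e) * (pi - - pi) = `|x| * (4 * pi / e) * `|x|.
    by field; rewrite gt_eqF.
  rewrite ler_wpM2r//; move: (ltW xc); rewrite /c => h.
  apply: le_trans (ler_wpM2r _ h) _; first by rewrite divr_ge0 ?mulr_ge0 ?ltW.
  have E (p : R) : 0 < p -> eps * e / (4 * p) * (4 * p / e) = eps.
    by move=> p0; field; rewrite !gt_eqF.
  by rewrite E.
Qed.

Lemma circle_mean_value : disk r z ->
  cintegral (- pi) pi (fun t => f (z * cis t)) = (2 * pi)%:C * f 0.
Proof.
move=> zr; have sr s : 0 <= s <= 1 -> disk r (s%:C * z).
  move=> /andP[s0 s1]; rewrite /disk /= cmodM cmod_real ger0_norm//.
  by apply: le_lt_trans zr; rewrite ler_piMl ?cmod_ge0.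
(* Multiplication by s turns the integrand into w f'(w). The case s > 0 is enough for the mean value
   theorem, whose intermediate point is interior. *)
have D0 s : 0 < s -> s <= 1 -> D s = 0.
  move=> s0 s1; have s0C : s%:C != 0 :> R[i] by rewrite -cmod_gt0 cmod_real normr_gt0 gt_eqF.
  have zsr : disk r (s%:C * z) by apply: sr; rewrite ltW.
  apply: (mulfI s0C); rewrite mulr0 -(cintegral_circle_derivative fdf (fun t => on_circle t zsr)).
  rewrite -cintegralZ; first by congr cintegral; apply/funext => t; rewrite !mulrA.
  exact: continuous_mulc (@continuous_circle z)
    (continuous_circle_derivative fdf (fun t => on_circle t zsr)).
(* The mean value theorem is for real functions: [p] will be the real and then the imaginary
   part. *)
have J01 (p : R[i] -> R) : p 0 = 0 -> (forall s, 0 <= s <= 1 ->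
    is_derive s 1 (fun s => p (J s)) (p (D s))) -> p (J 1) = p (J 0).
  move=> p0 dJ.
  have [||c] := @MVT R (fun s => p (J s)) (fun s => p (D s)) 0 1 ltr01.
  - by move=> s; rewrite in_itv /= => /andP[s0 s1]; apply: dJ; rewrite !ltW.
  - apply: derivable_within_continuous => s; rewrite in_itv /= => s01.
    by have [] := dJ s s01.
  - rewrite in_itv /= => /andP[c0 c1]; rewrite D0 ?(ltW c1)// p0 mul0r.
    by move=> /eqP; rewrite subr_eq0 => /eqP.
have J10 : J 1 = J 0.
  apply/eqP; rewrite eq_complex; apply/andP; split; apply/eqP.
  - by apply: J01 => // s /sr /J_derivative /curve_derivativeP[].
  - by apply: J01 => // s /sr /J_derivative /curve_derivativeP[].
have -> : cintegral (- pi) pi (fun t => f (z * cis t)) = J 1.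
  by rewrite /J; congr cintegral; apply/funext => t; rewrite mul1r.
rewrite J10 /J; under [in LHS]eq_fun do rewrite mul0r mul0r.
rewrite cintegral_cst ?(ltW NpiLpi)//; congr (_%:C * _); ring.
Qed.

End MeanValue.

Lemma strong_derivativeX U f df n : strong_derivative U f df ->
  strong_derivative U (fun z => f z ^+ n.+1) (fun z => n.+1%:R * f z ^+ n * df z).
Proof.
move=> fdf; elim: n => [|n IH].
  rewrite (_ : (fun z => f z ^+ 1) = f)//.
  rewrite (_ : (fun z => _ * _ * df z) = df)//.
  by apply/funext => z; rewrite expr0 mulr1 mul1r.
have H := strong_derivativeM fdf IH.
rewrite (_ : (fun z => f z ^+ n.+2) = (fun z => f z * f z ^+ n.+1)); last first.
  by apply/funext => z; rewrite exprS.
rewrite (_ : (fun z => _ * _ * df z) =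
  (fun z => df z * f z ^+ n.+1 + f z * (n.+1%:R * f z ^+ n * df z)))//.
by apply/funext => z; rewrite (exprS _ n) -[n.+2%:R]natr1; ring.
Qed.

Lemma continuous_circle_integrand r n h z : smooth (disk r) 1 h ->
  disk r z -> z != 0 ->
  continuous (fun t => h (z * cis t) * (z * cis t)^-1 ^+ n).
Proof.
move=> [dh hdh _] zr z0; apply: continuous_mulc.
  apply: continuous_circle_comp hdh _ => t.
  by rewrite /disk /= cmodM cmod_cis mulr1.
have vU : strong_derivative [set w : R[i] | w != 0]
    (fun w => w^-1) (fun w => - (w^-1 ^+ 2)).
  by apply: strong_derivativeV => /=; rewrite eqxx.
have [dv vnU _] : smooth [set w : R[i] | w != 0] 1 (fun w => w^-1 ^+ n).
  by apply: smoothX; exists (fun w => - (w^-1 ^+ 2)).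
apply: continuous_circle_comp vnU _ => t.
by rewrite /= -cmod_gt0 cmodM cmod_cis mulr1 cmod_gt0.
Qed.

Lemma circle_coef r n h g z : smooth (disk r) n.+1 h ->
  (forall w, disk r w -> h w = g w) -> disk r z -> z != 0 ->
  cintegral (- pi) pi (fun t => h (z * cis t) * (z * cis t)^-1 ^+ n) =
  (2 * pi)%:C / n`!%:R * (g^`(n) 0)%classic.
Proof.
move=> + + zr z0; elim: n h g => [|n IH] h g [dh hdh sdh] hg.
  have r0 : cmod (0 : R[i]) < r by rewrite cmod0 (le_lt_trans (cmod_ge0 z)).
  under eq_fun do rewrite expr0 mulr1.
  by rewrite (circle_mean_value hdh zr) fact0 divr1 derive1n0 hg.
have gdh := eq_strong_derivative (@disk_open R r) hg hdh.
have IHg := IH dh (g^`())%classic sdh (fun w wr => esym (strong_derivative_derive1 gdh wr)).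
pose U := disk r `&` [set w : R[i] | w != 0].
have zU t : U (z * cis t).
  split; first by rewrite /disk /= cmodM cmod_cis mulr1.
  by rewrite /= -cmod_gt0 cmodM cmod_cis mulr1 cmod_gt0.
have hU : strong_derivative U h dh by move=> w [] /hdh.
have vU : strong_derivative U (fun w => w^-1) (fun w => - (w^-1 ^+ 2)).
  by apply: strong_derivativeV => -[] _ /=; rewrite eqxx.
have kU := strong_derivativeM hU (strong_derivativeX n vU).
have c1 : continuous (fun t => dh (z * cis t) * (z * cis t)^-1 ^+ n).
  by apply: continuous_circle_integrand zr z0; have [ddh] := sdh; exists ddh.
have c2 : continuous (fun t => h (z * cis t) * (z * cis t)^-1 ^+ n.+1).
  by apply: continuous_circle_integrand zr z0; exists dh.
have := cintegral_circle_derivative kU zU.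
have -> : (fun t => z * cis t * (dh (z * cis t) * (z * cis t)^-1 ^+ n.+1
      + h (z * cis t) * (n.+1%:R * (z * cis t)^-1 ^+ n * - (z * cis t)^-1 ^+ 2))) =
    (fun t => dh (z * cis t) * (z * cis t)^-1 ^+ n
      + - n.+1%:R * (h (z * cis t) * (z * cis t)^-1 ^+ n.+1)).
  apply/funext => t; have [_ /= w0] := zU t; set w := z * cis t in w0 *.
  transitivity ((w * w^-1) * (dh w * w^-1 ^+ n
    + - n.+1%:R * (h w * w^-1 ^+ n.+1))); last by rewrite divff// mul1r.
  by rewrite !(exprS _ n) !expr2; ring.
rewrite (cintegralD _ _ c1 (@continuous_mulcl _ _ c2)).
rewrite (cintegralZ _ _ _ c2) IHg => /eqP; rewrite mulNr subr_eq0 => /eqP E.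
have n0 : n.+1%:R != 0 :> R[i] by rewrite pnatr_eq0.
have F0 : n`!%:R != 0 :> R[i] by rewrite pnatr_eq0 -lt0n fact_gt0.
apply: (mulfI n0); rewrite -E derive1Sn factS natrM.
by move: (n.+1%:R) (n`!%:R) n0 F0 => a b a0 b0; field; rewrite a0 b0.
Qed.

Lemma taylor_coef_circle r n h z : smooth (disk r) n.+1 h -> disk r z ->
  z != 0 ->
  taylor_coef h n = (2 * pi)%:C^-1 *
    cintegral (- pi) pi (fun t => h (z * cis t) * (z * cis t)^-1 ^+ n).
Proof.
move=> sh zr z0; rewrite (circle_coef sh (fun w _ => erefl) zr z0) /taylor_coef.
have pi0 : (2 * pi)%:C != 0 :> R[i].
  by rewrite -cmod_gt0 cmod_real normr_gt0 gt_eqF// mulr_gt0 ?pi_gt0.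
have F0 : n`!%:R != 0 :> R[i] by rewrite pnatr_eq0 -lt0n fact_gt0.
by move: ((2 * pi)%:C) (n`!%:R) pi0 F0 => a b a0 b0; field; rewrite a0 b0.
Qed.

End Circle.

(** * Exponential, logarithm and powers *)

Section ComplexExponential.
Context {R : realType}.
Implicit Types (x y w : R[i]).

Lemma cexp0 : cexp 0 = 1 :> R[i].
Proof. by rewrite /cexp /= expR0 cos0 sin0 mul1r. Qed.

Lemma cexpD x y : cexp (x + y) = cexp x * cexp y.
Proof.
case: x y => a b [c d]; rewrite /cexp /= expRD cosD sinD.
by simpc; congr (_ +i* _); ring.
Qed.

Lemma cexp_sum (I : Type) (s : seq I) (F : I -> R[i]) :
  cexp (\sum_(i <- s) F i) = \prod_(i <- s) cexp (F i).
Proof. by elim/big_rec2: _ => [|i u v _ <-]; rewrite ?cexp0 ?cexpD. Qed.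

Lemma cexpMn n x : cexp (n%:R * x) = cexp x ^+ n.
Proof.
elim: n => [|n IH]; first by rewrite mul0r expr0 cexp0.
by rewrite -natr1 mulrDl mul1r cexpD IH exprSr.
Qed.

Lemma cexpN x : cexp (- x) = (cexp x)^-1.
Proof.
have E : cexp (- x) * cexp x = 1 by rewrite -cexpD addNr cexp0.
have x0 : cexp x != 0.
  by apply/eqP => x0; move/eqP: E; rewrite x0 mulr0 eq_sym oner_eq0.
by rewrite -[LHS](mulfK x0) E mul1r.
Qed.

Lemma cexp_cln w : w != 0 -> cexp (cln w) = w.
Proof.
rewrite -cmod_gt0 => w0; rewrite /cexp /cln /= lnK ?posrE//.
have /andP[lo up] : -1 <= complex.Re w / cmod w <= 1.
  rewrite -ler_norml normrM normfV (gtr0_norm w0) ler_pdivrMr// mul1r.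
  exact: normRe_le.
have c1 : complex.Re w / cmod w \in `[(-1), 1]%R by rewrite in_itv /= lo.
have cosE : cos (carg w) = complex.Re w / cmod w.
  by rewrite /carg; case: ifP => _; rewrite ?cosN acosK.
have w2 : cmod w ^+ 2 = complex.Re w ^+ 2 + complex.Im w ^+ 2.
  by case: w {w0 lo up c1 cosE} => a b; rewrite /cmod /= sqr_sqrtr// addr_ge0 ?sqr_ge0.
(* The sine of an [acos] is nonnegative, so it gives |Im w| / |w|; the case distinction in [carg]
   restores the sign. *)
have sinE : sin (carg w) = complex.Im w / cmod w.
  have h : sin (acos (complex.Re w / cmod w)) = `|complex.Im w| / cmod w.
    rewrite sin_acos ?lo//.
    have -> : 1 - (complex.Re w / cmod w) ^+ 2 = (complex.Im w / cmod w) ^+ 2.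
      rewrite !expr_div_n.
      have -> : complex.Im w ^+ 2 = cmod w ^+ 2 - complex.Re w ^+ 2.
        by rewrite w2; ring.
      by field; rewrite gt_eqF.
    by rewrite sqrtr_sqr normrM normfV (gtr0_norm w0).
  rewrite /carg; case: ltP => i0; rewrite ?sinN h.
    by rewrite ltr0_norm// mulNr opprK.
  by rewrite ger0_norm.
rewrite cosE sinE; clear -w0; move: (cmod w) w0 => c c0; case: w => a b /=.
by simpc; congr (_ +i* _); field; rewrite gt_eqF.
Qed.

Lemma slit_plane_Re_gt0 w : 0 < complex.Re w -> slit_plane w.
Proof. by move=> w0 [_]; rewrite leNgt w0. Qed.

Lemma Re_gt0_neq0 w : 0 < complex.Re w -> w != 0.
Proof. by move=> w0; apply/eqP => wE; rewrite wE ltxx in w0. Qed.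

Lemma near_Re_gt0 (T : Type) (F : set_system T) (FF : Filter F) (u : T -> R[i]) l :
  u @ F --> l -> 0 < complex.Re l -> \forall x \near F, 0 < complex.Re (u x).
Proof.
move=> ul l0; have H := (@cvg_cmodP _ _ F FF u l).1 ul _ l0.
near=> x; have h : cmod (u x - l) < complex.Re l by near: x; exact: H.
have := le_lt_trans (normRe_le _) h; rewrite raddfB /= ltr_norml; lra.
Unshelve. all: by end_near. Qed.

Lemma near_cmod_lt (T : Type) (F : set_system T) (FF : Filter F) (u : T -> R[i]) l (c : R) :
  u @ F --> l -> cmod l < c -> \forall x \near F, cmod (u x) < c.
Proof.
rewrite -subr_gt0 => ul l0; have H := (@cvg_cmodP _ _ F FF u l).1 ul _ l0.
near=> x; have h : cmod (u x - l) < c - cmod l by near: x; exact: H.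
have := cmodD (u x - l) l; rewrite subrK; lra.
Unshelve. all: by end_near. Qed.

End ComplexExponential.

(** * Continuity of real powers in the exponent and in the base *)

Section PowerContinuity.
Context {R : realType}.

Lemma continuous_powR_exponent (y : R) : 0 < y -> continuous (fun a : R => y `^ a).
Proof.
move=> y0 a; rewrite /powR gt_eqF//.
apply: (@cvg_comp _ _ _ (fun a : R => a * ln y) expR).
  by apply: cvgM; [exact: cvg_id|exact: cvg_cst].
exact: continuous_expR.
Qed.

(** With the exponent fixed there is no trouble at x = a = 0, where the power is constantly 1;
    moving the base from the right keeps it nonnegative. *)
Lemma powR_base_right_cvg (x a : R) : 0 <= x -> 0 <= a ->
  (x + h) `^ a @[h --> 0^'+] --> x `^ a.
Proof.
move=> x0 a0; have [->|an0] := eqVneq a 0.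
  by under eq_fun do rewrite powRr0; rewrite powRr0; exact: cvg_cst.
have {an0}a0 : 0 < a by rewrite lt_neqAle eq_sym an0.
have [->|xn0] := eqVneq x 0.
  by under eq_fun do rewrite add0r; rewrite powR0 ?gt_eqF//; exact: powR_cvg0.
have {xn0}x0 : 0 < x by rewrite lt_neqAle eq_sym xn0.
apply: (@cvg_comp _ _ _ (fun h : R => x + h) (fun y => y `^ a) _ (nbhs x)).
  have : x + h @[h --> 0^'+] --> x + 0.
    by apply: cvgD; [exact: cvg_cst|exact: cvg_at_right_filter].
  by rewrite addr0.
suff c : {for x, continuous (fun y : R => y `^ a)} by exact: c.
apply/differentiable_continuous; rewrite -derivable1_diffP.
by apply: derivable_powR; rewrite in_itv/= andbT.
Qed.

Lemma cvg_big_prod (T I : Type) (s : seq I) (F : set_system T) (FF : Filter F)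
  (u : I -> T -> R) (l : I -> R) : (forall i, u i @ F --> l i) ->
  (fun x => \prod_(i <- s) u i x) @ F --> \prod_(i <- s) l i.
Proof.
move=> ul; elim: s => [|i s IH].
  by under eq_fun do rewrite big_nil; rewrite big_nil; exact: cvg_cst.
under eq_fun do rewrite big_cons; rewrite big_cons.
by apply: cvgM; [exact: ul|exact: IH].
Qed.

(* [x `^ a] is discontinuous at [x = a = 0], but only upper semicontinuity is
   needed, and enlarging the bases moves them away from [0]. *)
Lemma prod_powR_enlarge m (x a : 'I_m -> R) (c : R) :
  (forall j, 0 <= x j) -> (forall j, 0 <= a j) ->
  \prod_j x j `^ a j < c ->
  exists2 y : 'I_m -> R, (forall j, x j < y j) & \prod_j y j `^ a j < c.
Proof.
move=> x0 a0 xc.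
have cvgp : (fun h => \prod_j (x j + h) `^ a j) @ (0 : R)^'+ --> \prod_j x j `^ a j.
  by apply: cvg_big_prod => j; exact: powR_base_right_cvg.
have [h [h0 hc]] : exists h : R, 0 < h /\ \prod_j (x j + h) `^ a j < c.
  apply: (@filter_ex _ (0 : R)^'+); near=> h; split.
    by near: h; exact: nbhs_right_gt.
  by near: h; exact: cvgr_lt cvgp _ xc.
by exists (fun j => x j + h) => // j; rewrite ltrDl.
Unshelve. all: by end_near. Qed.

End PowerContinuity.

(** * Uniform bounds *)

Section Norm.
Context {R : realType} {m : nat}.
Variable N : 'rV[R]_m.+1 -> R.
Hypothesis hN : is_norm N.

Lemma is_norm0 : N 0 = 0.
Proof.
by have [_ NZ _] := hN; rewrite -(scale0r (0 : 'rV[R]_m.+1)) NZ normr0 mul0r.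
Qed.

Lemma is_normN u : N (- u) = N u.
Proof. by have [_ NZ _] := hN; rewrite -scaleN1r NZ normrN1 mul1r. Qed.

Lemma is_norm_ge0 u : 0 <= N u.
Proof.
have [ND _ _] := hN; have := ND u (- u); rewrite subrr is_norm0 is_normN; lra.
Qed.

Lemma is_norm_gt0 u : u != 0 -> 0 < N u.
Proof.
have [_ _ Neq0] := hN; rewrite lt0r is_norm_ge0 andbT; apply: contra_neq.
exact: Neq0.
Qed.

Lemma is_norm_near (u : 'rV[R]_m.+1) (e : R) : 0 < e -> \forall v \near u, N (v - u) < e.
Proof.
move=> e0; have [ND NZ _] := hN.
pose C := \sum_i N (delta_mx 0 i) + 1.
have C0 : 0 < C by rewrite ltr_wpDl// sumr_ge0// => i _; exact: is_norm_ge0.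
have coord i : \forall v \near u, `|(v : 'rV[R]_m.+1) 0 i - u 0 i| < e / C.
  have /cvgrPdist_lt/(_ (e / C)) := @coord_continuous R 1 m.+1 0 i u.
  rewrite divr_gt0// => /(_ erefl) H; near=> v; rewrite distrC.
  by near: v; exact: H.
have Nsum v : N v <= \sum_i `|v 0 i| * N (delta_mx 0 i).
  rewrite [v in N v]row_sum_delta; elim/big_rec2: _ => [|i x y _ h].
    by rewrite is_norm0.
  by apply: le_trans (ND _ _) _; rewrite NZ lerD2l.
have H := filter_forall _ coord.
near=> v; apply: le_lt_trans (Nsum _) _.
have vH i : `|v 0 i - u 0 i| < e / C by move: i; near: v; exact: H.
apply: (@le_lt_trans _ _ (\sum_i e / C * N (delta_mx 0 i))).
  apply: ler_sum => i _; rewrite !mxE ler_wpM2r ?is_norm_ge0//; exact: ltW.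
rewrite -mulr_sumr mulrAC ltr_pdivrMr// ltr_pM2l// /C; lra.
Unshelve. all: by end_near. Qed.

(* Compactness of [D `*` D] replaces the equivalence of [N] with the sup norm,
   so that only the continuity of [N] is needed. *)
Lemma compact_norm_uniform (D : set 'rV[R]_m.+1) (Z : 'rV[R]_m.+1 -> R[i]) z0 (del : R) :
  compact D -> {within D, continuous Z} -> 0 < del ->
  exists2 e : R, 0 < e & forall u d, D u -> D d -> Z u = z0 ->
    N (d - u) < e -> cmod (Z d - z0) < del.
Proof.
move=> cD cZ del0; have [ND _ _] := hN.
have Znear d0 (c : R) : D d0 -> 0 < c ->
    \forall d \near d0, D d -> cmod (Z d - Z d0) < c.
  move=> Dd0 c0; move/subspace_continuousP : cZ => /(_ _ Dd0) h.
  exact: (@cvg_cmodP _ _ _ (within_filter _ _) _ _).1 h _ c0.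
pose P (e : R) (p : 'rV[R]_m.+1 * 'rV[R]_m.+1) :=
  Z p.1 = z0 -> N (p.2 - p.1) < e -> cmod (Z p.2 - z0) < del.
have cov p : (D `*` D) p -> \forall p' \near p & e \near 0^'+, (D `*` D) p' -> P e p'.
  case: p => u0 d0 [/= Du0 Dd0].
  (* If [Z u0] differs from [z0], the premise fails near [u0] by continuity. If [u0 = d0], the
     conclusion is the continuity of [Z] there. Otherwise the two points stay apart in norm, so that
     a small [e] contradicts the distance hypothesis. *)
  have [Zu0|Zu0] := eqVneq (Z u0) z0; last first.
    have c0 : 0 < cmod (z0 - Z u0) by rewrite cmod_gt0 subr_eq0 eq_sym.
    have H : \forall p \near (u0, d0), D p.1 -> cmod (Z p.1 - Z u0) < cmod (z0 - Z u0).
      exact: cvg_fst (Znear _ _ Du0 c0).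
    near=> p e => -[/= Dp1 _] Zp1.
    have : D p.1 -> cmod (Z p.1 - Z u0) < cmod (z0 - Z u0) by near: p; exact: H.
    by rewrite Zp1 ltxx => /(_ Dp1).
  have [ud|ud] := eqVneq u0 d0.
    have H : \forall p \near (u0, d0), D p.2 -> cmod (Z p.2 - Z d0) < del.
      exact: cvg_snd (Znear _ _ Dd0 del0).
    near=> p e => -[/= _ Dp2] _ _.
    have : D p.2 -> cmod (Z p.2 - Z d0) < del by near: p; exact: H.
    by rewrite -ud Zu0 => /(_ Dp2).
  have k0 : 0 < N (d0 - u0) by rewrite is_norm_gt0// subr_eq0 eq_sym.
  have k30 : 0 < N (d0 - u0) / 3 by rewrite divr_gt0.
  have H1 : \forall p \near (u0, d0), N (p.1 - u0) < N (d0 - u0) / 3.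
    exact: cvg_fst (is_norm_near u0 k30).
  have H2 : \forall p \near (u0, d0), N (p.2 - d0) < N (d0 - u0) / 3.
    exact: cvg_snd (is_norm_near d0 k30).
  near=> p e => _ _ pe; exfalso.
  have h1 : N (p.1 - u0) < N (d0 - u0) / 3 by near: p; exact: H1.
  have h2 : N (p.2 - d0) < N (d0 - u0) / 3 by near: p; exact: H2.
  have h3 : e < N (d0 - u0) / 3 by near: e; exact: nbhs_right_lt.
  have E : d0 - u0 = (- (p.2 - d0) + (p.2 - p.1)) + (p.1 - u0).
    by rewrite opprB [d0 - p.2 + _]addrA subrK addrA subrK.
  have t1 : N (d0 - u0) <= N (p.2 - d0) + N (p.2 - p.1) + N (p.1 - u0).
    rewrite E; apply: le_trans (ND _ _) _; rewrite lerD2r.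
    by apply: le_trans (ND _ _) _; rewrite is_normN.
  by move: pe => /=; lra.
have /compact_near_coveringP/near_covering_withinP := compact_setX cD cD.
move=> /(_ _ _ _ (at_right_proper_filter 0) cov) near_e.
have [e [e0 eP]] : exists e : R, 0 < e /\ (D `*` D) `<=` P e.
  apply: (@filter_ex _ (0 : R)^'+).
  by near=> e; split; [near: e; exact: nbhs_right_gt|near: e].
by exists e => // u d Du Dd Zu; exact: (eP (u, d)).
Unshelve. all: by end_near. Qed.

End Norm.

(** * Uniform control of the arguments of the logarithms *)

Section LogArguments.
Context {R : realType} {m : nat}.
Variables (r : R) (f : 'I_m -> R[i] -> R[i]) (D : set 'rV[R]_m.+1)
  (Z : 'rV[R]_m.+1 -> R[i]).
Hypothesis f_analytic : forall j, analytic_on (disk r) (f j).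
Hypothesis Z_cont : {within D, continuous Z}.
Hypothesis Z_disk : forall d, D d -> disk r (Z d).
Hypothesis fZ_neq0 : forall d j, D d -> f j (Z d) != 0.

Lemma analytic_continuous j z : disk r z -> f j @ z --> f j z.
Proof.
move=> zr; have [fdf _] := analytic_strong_derivative (f_analytic j).
exact: strong_derivative_continuous fdf zr.
Qed.

(** [Z] is continuous relative to [D] only, hence the filter restricted in the direction and free in
    the angle. *)
Lemma log_arg_cvg d0 t0 j : D d0 ->
  (fun p => log_arg f Z p.2 p.1 j)
    @ within [set p | D p.1] (nbhs (d0, t0)) --> log_arg f Z t0 d0 j.
Proof.
move=> Dd0; set F := within _ _.
have FF : Filter F by exact: within_filter.
have Zc : (fun p : 'rV[R]_m.+1 * R => Z p.1) @ F --> Z d0.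
  move=> A AZ; have h : \forall d \near d0, D d -> A (Z d).
    by move/subspace_continuousP : Z_cont => /(_ _ Dd0 _ AZ).
  have : \forall p \near (d0, t0), D p.1 -> A (Z p.1) by exact: cvg_fst h.
  by [].
have tc : (fun p : 'rV[R]_m.+1 * R => cis p.2) @ F --> cis t0.
  move=> A At; have h : \forall t \near t0, A (cis t) by exact: continuous_cis At.
  have : \forall p \near (d0, t0), D p.1 -> A (cis p.2).
    by near=> p => _; near: p; exact: cvg_snd h.
  by [].
rewrite /log_arg; apply: cvgM; last first.
  apply: cvgV; first exact: fZ_neq0.
  apply: (@cvg_comp _ _ _ (fun p : 'rV[R]_m.+1 * R => Z p.1) (f j)); first exact: Zc.
  exact: analytic_continuous (Z_disk Dd0).
apply: (@cvg_comp _ _ _ (fun p : 'rV[R]_m.+1 * R => Z p.1 * cis p.2) (f j)).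
  by apply: cvgM; [exact: Zc|exact: tc].
apply: analytic_continuous; rewrite /disk /= cmodM cmod_cis mulr1.
exact: Z_disk.
Unshelve. all: by end_near. Qed.

Lemma log_arg0 d j : D d -> log_arg f Z 0 d j = 1.
Proof. by move=> Dd; rewrite /log_arg cexp0 mulr1 divff ?fZ_neq0. Qed.

Lemma log_arg_Re_gt0_uniform : compact D ->
  exists2 e : R, 0 < e & forall d t j, D d -> `|t| < e ->
    0 < complex.Re (log_arg f Z t d j).
Proof.
move=> cD; pose P (t : R) d := forall j, 0 < complex.Re (log_arg f Z t d j).
have cov d : D d -> \forall d' \near d & t \near (0 : R), D d' -> P t d'.
  move=> Dd.
  suff H : \forall p \near (d, 0 : R), forall j, D p.1 ->
      0 < complex.Re (log_arg f Z p.2 p.1 j).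
    have : \forall p \near (d, 0 : R), D p.1 -> P p.2 p.1.
      near=> p => Dp j; have Hp : forall j, D p.1 ->
        0 < complex.Re (log_arg f Z p.2 p.1 j) by near: p; exact: H.
      exact: Hp.
    by [].
  apply: (@filter_forall _ _ _ _ (nbhs_filter (d, 0 : R))) => j.
  apply: (@near_Re_gt0 _ _ _ (within_filter _ _) _ _ (@log_arg_cvg d 0 j Dd)).
  by rewrite log_arg0//= ltr01.
have /compact_near_coveringP/near_covering_withinP := cD.
move=> /(_ _ _ _ (nbhs_filter (0 : R)) cov) /nbhs_ballP[e /= e0 sub].
exists e => // d t j Dd te; apply: (sub t _ d Dd).
by rewrite -ball_normE /= sub0r normrN.
Unshelve. all: by end_near. Qed.

(** Meant for directions with [Z d] close to 0: [Z d] and [Z d * cis t] then both lie in the small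
    disk whatever t is, so the whole circle is covered at once. *)
Lemma ratio_Re_gt0_near0 : 0 < r -> (forall j, f j 0 != 0) ->
  exists2 e : R, 0 < e & forall j x y, cmod x < e -> cmod y < e ->
    0 < complex.Re (f j x / f j y).
Proof.
move=> r0 f0; have r0' : disk r (0 : R[i]).
  by have : cmod (0 : R[i]) < r by rewrite cmod0.
have H j : \forall e \near 0^'+, forall x y, cmod x < e -> cmod y < e ->
    0 < complex.Re (f j x / f j y).
  have c : (fun p : R[i] * R[i] => f j p.1 / f j p.2) @ (nbhs (0, 0)) --> f j 0 / f j 0.
    apply: cvgM; last apply: cvgV => //.
      apply: (@cvg_comp _ _ _ fst (f j)); [exact: cvg_fst|].
      exact: analytic_continuous.
    apply: (@cvg_comp _ _ _ snd (f j)); [exact: cvg_snd|].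
    exact: analytic_continuous.
  have := @near_Re_gt0 _ _ _ (nbhs_filter _) _ _ c.
  rewrite divff//= => /(_ ltr01) [[A B] [/= /nbhs_cmodP[a a0 Aa] /nbhs_cmodP[b b0 Bb]] sub].
  near=> e => x y xe ye; apply: (sub (x, y)); split => /=.
    apply: Aa; rewrite subr0 (lt_le_trans xe)//; near: e; exact: nbhs_right_le.
  apply: Bb; rewrite subr0 (lt_le_trans ye)//; near: e; exact: nbhs_right_le.
have [e [e0 He]] : exists e : R, 0 < e /\ forall j x y, cmod x < e -> cmod y < e ->
    0 < complex.Re (f j x / f j y).
  apply: (@filter_ex _ (0 : R)^'+); have H' := filter_forall _ H.
  by near=> e; split; [near: e; exact: nbhs_right_gt|near: e; exact: H'].
by exists e.
Unshelve. all: by end_near. Qed.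

Lemma prod_log_arg_uniform_lt1 (D1 : set 'rV[R]_m.+1) (A : set R) :
  compact D1 -> compact A -> D1 `<=` D -> (forall d j, D d -> 0 <= coordS d j) ->
  (forall d t, D1 d -> A t ->
    \prod_j cmod (log_arg f Z t d j) `^ coordS d j < 1) ->
  exists2 q : R, 0 < q < 1 & forall d t, D1 d -> A t ->
    \prod_j cmod (log_arg f Z t d j) `^ coordS d j < q.
Proof.
move=> cD1 cA D1D D_ge0 lt1.
pose P (q : R) (p : 'rV[R]_m.+1 * R) :=
  \prod_j cmod (log_arg f Z p.2 p.1 j) `^ coordS p.1 j < q.
have cov p : (D1 `*` A) p ->
    \forall p' \near p & q \near 1^'-, (D1 `*` A) p' -> P q p'.
  case: p => d0 t0 [/= D1d0 At0]; have Dd0 := D1D _ D1d0.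
  (* Joint continuity of the product may fail where a base and its exponent are both 0. The larger
     positive bases [y] bound the moduli near the point, and for them the product is continuous in
     the direction. *)
  have [y ylt yprod] := prod_powR_enlarge (fun j => cmod_ge0 _)
    (fun j => D_ge0 d0 j Dd0) (lt1 _ _ D1d0 At0).
  have y0 j : 0 < y j by exact: le_lt_trans (cmod_ge0 _) (ylt j).
  have Hy : \forall p \near (d0, t0), forall j, D p.1 -> cmod (log_arg f Z p.2 p.1 j) < y j.
    apply: (@filter_forall _ _ _ _ (nbhs_filter (d0, t0))) => j.
    exact: (@near_cmod_lt _ _ _ (within_filter _ _) _ _ _ (@log_arg_cvg d0 t0 j Dd0) (ylt j)).
  (* An intermediate [c] leaves room for every q in a left neighbourhood of 1, so that the covering
     can select one q < 1. *)
  have [c pc c1] : exists2 c, \prod_j y j `^ coordS d0 j < c & c < 1.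
    by exists ((\prod_j y j `^ coordS d0 j + 1) / 2); lra.
  have Hc : \forall p \near (d0, t0), \prod_j y j `^ coordS p.1 j < c.
    have cv : (fun d => \prod_j y j `^ coordS d j) @ d0 --> \prod_j y j `^ coordS d0 j.
      apply: (@cvg_big_prod R _ _ _ _ (nbhs_filter d0)) => j.
      apply: (@cvg_comp _ _ _ (fun d => coordS d j) (fun a => y j `^ a)).
        exact: coord_continuous.
      exact: continuous_powR_exponent.
    have h : \forall d \near d0, \prod_j y j `^ coordS d j < c by exact: cvgr_lt cv _ pc.
    exact: cvg_fst h.
  near=> p q => -[/= D1p Ap]; rewrite /P.
  have hy : forall j, D p.1 -> cmod (log_arg f Z p.2 p.1 j) < y j by near: p; exact: Hy.
  have hc : \prod_j y j `^ coordS p.1 j < c by near: p; exact: Hc.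
  have hq : c < q by near: q; exact: nbhs_left_gt.
  apply: le_lt_trans (lt_trans hc hq); apply: ler_prod => j _.
  rewrite powR_ge0 /=; apply: ge0_ler_powR.
  - by apply: D_ge0; exact: D1D.
  - by rewrite nnegrE cmod_ge0.
  - by rewrite nnegrE ltW.
  - by apply/ltW/hy; exact: D1D.
have /compact_near_coveringP/near_covering_withinP := compact_setX cD1 cA.
move=> /(_ _ _ _ (at_left_proper_filter 1) cov) near_q.
have [q [q01 qP]] : exists q : R, 0 < q < 1 /\ (D1 `*` A) `<=` P q.
  apply: (@filter_ex _ (1 : R)^'-).
  near=> q; split; last by near: q.
  by apply/andP; split; near: q; [exact: nbhs_left_gt|exact: nbhs_left_lt].
by exists q => // d t D1d At; exact: (qP (d, t)).
Unshelve. all: by end_near. Qed.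

End LogArguments.

(** * The integrand on the circle *)

Section SaddlePoint.
Context {R : realType} {m : nat}.
Implicit Types (f : 'I_m -> R[i] -> R[i]) (Z : 'rV[R]_m.+1 -> R[i])
  (d : 'rV[R]_m.+1) (n : 'rV[nat]_m.+1) (t : R) (z w : R[i]).

Lemma cis_neq1 t : 0 < `|t| <= pi -> cis t != 1 :> R[i].
Proof.
move=> /andP[t0 tpi]; apply/eqP; rewrite cisE => -[cost _].
have : `|t| = 0.
  apply: cos_inj; rewrite ?in_itv/= ?normr_ge0 ?tpi ?lexx ?pi_ge0//.
  by rewrite cos0 -cost; case: (ger0P t) => _; rewrite ?cosN.
by move=> tE; rewrite tE ltxx in t0.
Qed.

Lemma powR_prod (I : Type) (s : seq I) (x : I -> R) (a : R) :
  (forall i, 0 <= x i) -> (\prod_(i <- s) x i) `^ a = \prod_(i <- s) x i `^ a.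
Proof.
move=> x0; elim: s => [|i s IH]; first by rewrite !big_nil powR1.
by rewrite !big_cons powRM// ?IH// prodr_ge0.
Qed.

(** The product is the ratio of the weights at [Z d * cis t] and at [Z d]. These points are distinct
    since [Z d] is nonzero, and strict minimality then excludes equality. *)
Lemma prod_log_arg_lt1 r f d Z t :
  strictly_minimal_critical_point r f d (Z d) -> Z d != 0 -> 0 < `|t| <= pi ->
  \prod_j cmod (log_arg f Z t d j) `^ coordS d j < 1.
Proof.
move=> [[_ fz zmax _] zmin] z0 /cis_neq1 t1.
have ww : cmod (Z d * cis t) = cmod (Z d) by rewrite cmodM cmod_cis mulr1.
have wE : weight f d (Z d * cis t) =
    (\prod_j cmod (log_arg f Z t d j) `^ coordS d j) * weight f d (Z d).
  rewrite -big_split /=; apply: eq_bigr => j _.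
  by rewrite -powRM ?cmod_ge0// -cmodM /log_arg divfK.
have w0 : 0 < weight f d (Z d).
  by apply: prodr_gt0 => j _; rewrite powR_gt0// cmod_gt0.
rewrite -(ltr_pM2r w0) mul1r -wE lt_neqAle zmax// andbT.
apply/eqP => /(zmin _ ww) /eqP; rewrite -[X in _ == X]mulr1.
by move=> /eqP /(mulfI z0) /eqP; rewrite (negbTE t1).
Qed.

Lemma circle_integrandE f Z d n t : Z d != 0 -> (forall j, f j (Z d) != 0) ->
  (cis t)^-1 ^+ coord0 n * \prod_j log_arg f Z t d j ^+ coordS n j =
  Z d ^+ coord0 n / (\prod_j f j (Z d) ^+ coordS n j) *
  (\prod_j f j (Z d * cis t) ^+ coordS n j * (Z d * cis t)^-1 ^+ coord0 n).
Proof.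
move=> z0 fz.
have -> : \prod_j log_arg f Z t d j ^+ coordS n j =
    (\prod_j f j (Z d * cis t) ^+ coordS n j) / \prod_j f j (Z d) ^+ coordS n j.
  rewrite -prodf_div; apply: eq_bigr => j _.
  by rewrite /log_arg exprMn exprVn.
have zn : Z d ^+ coord0 n != 0 by rewrite expf_neq0.
have -> : (Z d * cis t)^-1 ^+ coord0 n = (cis t)^-1 ^+ coord0 n / Z d ^+ coord0 n.
  by rewrite invfM exprMn mulrC [(Z d)^-1 ^+ _]exprVn.
set A := \prod_j f j (Z d * cis t) ^+ _; set B := (\prod_j f j (Z d) ^+ _)^-1.
move: (Z d ^+ _) zn A B => u u0 A B; set v := _^-1 ^+ _.
transitivity ((u * u^-1) * (v * (A * B))); first by rewrite mulfV// mul1r.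
by ring.
Qed.

Section Integrand.
Variables (N : 'rV[R]_m.+1 -> R) (f : 'I_m -> R[i] -> R[i])
  (Z : 'rV[R]_m.+1 -> R[i]) (n : 'rV[nat]_m.+1).
Hypothesis Nn : 0 < N (rvec n).

Let d := direction N n.
Let s := N (rvec n).

Lemma direction_coord i : s * d 0 i = (n 0 i)%:R.
Proof.
by rewrite /d /direction /rvec !mxE mulrA mulfV ?mul1r// gt_eqF.
Qed.

(** Since [s * d] is the integer vector [n], each logarithm is multiplied by an integer before
    exponentiation, which removes the dependence on the branch. *)
Lemma cexp_phase t : (forall j, log_arg f Z t d j != 0) ->
  cexp (- s%:C * phase f Z t d) =
  (cis t)^-1 ^+ coord0 n * \prod_j log_arg f Z t d j ^+ coordS n j.
Proof.
move=> la0.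
have -> : - s%:C * phase f Z t d = (coord0 n)%:R * (- (0 +i* t))
    + \sum_j (coordS n j)%:R * cln (log_arg f Z t d j).
  rewrite /phase mulrBr [- s%:C * \sum_j _]mulNr opprK mulr_sumr; congr (_ + _).
    rewrite mulNr mulrN; congr (- _).
    rewrite -(rmorph_nat (real_complex R)) -(direction_coord ord0) /coord0.
    by simpc; congr (_ +i* _); ring.
  apply: eq_bigr => j _; rewrite mulrA -rmorphM /= direction_coord.
  by rewrite rmorph_nat.
rewrite cexpD cexpMn cexpN cexp_sum; congr (_ * _).
by apply: eq_bigr => j _; rewrite cexpMn cexp_cln.
Qed.

(** The same homogeneity makes the modulus the s-th real power of a product below [q]; this is where
    decay exponential in |n| arises. *)
Lemma cmod_circle_integrand_le t (q : R) : 0 < q ->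
  \prod_j cmod (log_arg f Z t d j) `^ coordS d j < q ->
  cmod ((cis t)^-1 ^+ coord0 n * \prod_j log_arg f Z t d j ^+ coordS n j)
  <= expR (s * ln q).
Proof.
move=> q0 lq; rewrite cmodM cmodX cmodV cmod_cis invr1 expr1n mul1r cmod_prod.
have -> : \prod_j cmod (log_arg f Z t d j ^+ coordS n j) =
    (\prod_j cmod (log_arg f Z t d j) `^ coordS d j) `^ s.
  rewrite powR_prod => [|j]; last exact: powR_ge0.
  apply: eq_bigr => j _; rewrite cmodX -powRrM mulrC direction_coord.
  by rewrite powR_mulrn// cmod_ge0.
have -> : expR (s * ln q) = q `^ s by rewrite /powR gt_eqF.
apply: ge0_ler_powR; rewrite ?nnegrE ?(ltW Nn) ?(ltW q0) ?(ltW lq)//.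
by apply: prodr_ge0 => j _; exact: powR_ge0.
Qed.

End Integrand.

End SaddlePoint.

(** * The choice of the radius and the two expansions *)

Theorem theorem1 (R : realType) (m : nat) (hm : (1 <= m)%N)
    (N : 'rV[R]_m.+1 -> R) (hN : is_norm N)
    (r : R) (hr : 0 < r) (f : 'I_m -> R[i] -> R[i])
    (f_analytic : forall j, analytic_on (disk r) (f j))
    (f_nonconstant : forall j, ~ constant_on (disk r) (f j))
    (f0 : forall j, f j 0 != 0)
    (D : set 'rV[R]_m.+1) (D_sub : D `<=` sphere_ge0 N) (D_compact : compact D)
    (Z : 'rV[R]_m.+1 -> R[i]) (Z_cont : {within D, continuous Z})
    (Z_crit : forall d, D d -> strictly_minimal_critical_point r f d (Z d)) :
  let Z0 := D `&` Z @^-1` [set 0] in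
  exists2 e : R, 0 < e &
    (forall D1 : set 'rV[R]_m.+1, compact D1 -> D1 `<=` D `\` Z0 ->
      (forall d (t : R) j, D1 d -> - e <= t <= e -> slit_plane (log_arg f Z t d j)) /\
      exists2 c : R, 0 < c & exists K : R,
        forall n : 'rV[nat]_m.+1, n != 0 -> D1 (direction N n) ->
        exists2 E : R[i], cmod E <= K * expR (- (N (rvec n) * c)) &
          prod_coef f n =
          prefactor f (Z (direction N n)) n * (phase_integral N f Z (- e) e n + E))
    /\
    (forall D0 : set 'rV[R]_m.+1,
      D0 `<=` [set u + v | u in Z0 & v in norm_ball N e] `&` (D `\` Z0) ->
      (forall d (t : R) j, D0 d -> - pi <= t <= pi -> slit_plane (log_arg f Z t d j)) /\
      forall n : 'rV[nat]_m.+1, n != 0 -> D0 (direction N n) ->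
        prod_coef f n =
        prefactor f (Z (direction N n)) n * phase_integral N f Z (- pi) pi n).
Proof.
move=> Z0.
have Z_disk d : D d -> disk r (Z d) by move=> /Z_crit[[]].
have fZ d j : D d -> f j (Z d) != 0 by move=> /Z_crit[[]].
have D_ge0 d j : D d -> 0 <= coordS d j by move=> /D_sub[h _]; exact: h.
have DZ0 d : (D `\` Z0) d -> D d /\ Z d != 0.
  by move=> [Dd nZ]; split=> //; apply/eqP => Zd; apply: nZ; split.
have Nn (n : 'rV[nat]_m.+1) : n != 0 -> 0 < N (rvec n).
  move=> n0; apply: is_norm_gt0 => //; apply: contra_neq n0 => n0.
  by apply/rowP => i; move/rowP/(_ i)/eqP: n0; rewrite !mxE pnatr_eq0 => /eqP.
have [e1 e10 He1] := log_arg_Re_gt0_uniform f_analytic Z_cont Z_disk fZ D_compact.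
have [del del0 Hdel] := ratio_Re_gt0_near0 f_analytic hr f0.
have [e2 e20 He2] := compact_norm_uniform hN 0 D_compact Z_cont del0.
have pi2 := pi_ge2 R.
(* [G] is the Cauchy integrand, and [C] the inverse of its value at t = 0; inserting [C] isolates
   [prefactor], which carries the 2 pi. *)
pose G (n : 'rV[nat]_m.+1) z t :=
  \prod_j f j (z * cis t) ^+ coordS n j * (z * cis t)^-1 ^+ coord0 n.
pose C (n : 'rV[nat]_m.+1) z := z ^+ coord0 n / \prod_j f j z ^+ coordS n j.
have sm (n : 'rV[nat]_m.+1) k :
    smooth (disk r) k (fun z => \prod_j f j z ^+ coordS n j).
  by apply: smooth_prod => j; apply: smoothX; exact: analytic_smooth.
have cG n z : disk r z -> z != 0 -> continuous (G n z).
  by move=> zr z0; exact: continuous_circle_integrand (sm n 1%N) zr z0.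
have coefE n d : D d -> Z d != 0 ->
    prod_coef f n = prefactor f (Z d) n * (C n (Z d) * cintegral (- pi) pi (G n (Z d))).
  move=> Dd z0; rewrite /prod_coef (taylor_coef_circle (sm n _) (Z_disk _ Dd) z0).
  rewrite mulrA; congr (_ * _); rewrite /prefactor /C.
  have zn : Z d ^+ coord0 n != 0 by rewrite expf_neq0.
  have hn : \prod_j f j (Z d) ^+ coordS n j != 0.
    by apply/prodf_neq0 => j _; rewrite expf_neq0// fZ.
  have p0 : (2 * pi)%:C != 0 :> R[i].
    by rewrite -cmod_gt0 cmod_real normr_gt0 gt_eqF// mulr_gt0 ?pi_gt0.
  move: (Z d ^+ _) zn (\prod_j _) hn ((2 * pi)%:C) p0 => a a0 b b0 c c0.
  by field; rewrite a0 b0 c0.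
have phaseE (n : 'rV[nat]_m.+1) a b : n != 0 -> let d := direction N n in
    D d -> Z d != 0 ->
    (forall t j, a <= t <= b -> log_arg f Z t d j != 0) ->
    phase_integral N f Z a b n = C n (Z d) * cintegral a b (G n (Z d)).
  move=> n0 d Dd z0 la; rewrite -cintegralZ; last exact: cG (Z_disk _ Dd) z0.
  apply: eq_cintegral => t tab; rewrite cexp_phase ?Nn// => [|j]; last exact: la.
  by apply: circle_integrandE => // j; exact: fZ.
(* Halving [e1] makes the closed interval [-e, e] admissible for the logarithms, [e2] brings [Z d]
   near 0 in the small exponent case, and 1 < pi keeps the interval inside [-pi, pi]. *)
pose e := Num.min (Num.min (e1 / 2) e2) 1.
have e0 : 0 < e by rewrite !lt_min e20 divr_gt0/=.
have ee1 : e < e1.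
  by apply: (@le_lt_trans _ _ (e1 / 2)); [rewrite /e !ge_min lexx|lra].
have ee2 : e <= e2 by rewrite /e !ge_min lexx orbT.
have e1' : e <= 1 by rewrite /e ge_min lexx orbT.
have Re_e d t j : D d -> - e <= t <= e -> 0 < complex.Re (log_arg f Z t d j).
  by move=> Dd te; apply: He1 => //; apply: le_lt_trans ee1; rewrite ler_norml.
clearbody e; exists e => //; split=> [D1 cD1 D1D|D0 D0D].
- split=> [d t j /D1D/DZ0[Dd _] te|]; first exact/slit_plane_Re_gt0/Re_e.
  (* The arcs left out by the integral form a compact set avoiding t = 0, so [q] depends on [D1] and
     [e] but not on [n]. *)
  have [|||||q /andP[q0 q1] Hq] :=
    @prod_log_arg_uniform_lt1 R m r f D Z f_analytic Z_cont Z_disk fZ D1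
      (`[(- pi), (- e)] `|` `[e, pi]).
  + exact: cD1.
  + by apply: compactU; exact: segment_compact.
  + by move=> d /D1D/DZ0[].
  + exact: D_ge0.
  + move=> d t /D1D/DZ0[Dd z0] te; apply: prod_log_arg_lt1 (Z_crit _ Dd) z0 _.
    case: te => /=; rewrite in_itv/= => /andP[t1 t2].
      by rewrite ltr0_norm; lra.
    by rewrite gtr0_norm; lra.
  exists (- ln q); first by rewrite oppr_gt0 ln_lt0// q0.
  (* Two arcs, each of length at most pi, and the factor 2 of [cmod_cintegral_le]. *)
  exists (4 * pi) => n n0 D1n; set d := direction N n in D1n *.
  have [Dd z0] := DZ0 _ (D1D _ D1n); have zr := Z_disk _ Dd.
  have cGd := cG n _ zr z0.
  (* The error term is the exact contribution of the two omitted arcs. *)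
  exists (C n (Z d) * cintegral (- pi) (- e) (G n (Z d))
          + C n (Z d) * cintegral e pi (G n (Z d))).
    have bound a b : a <= b -> b - a <= pi ->
        (forall t, a <= t <= b -> (`[(- pi), (- e)] `|` `[e, pi]) t) ->
        cmod (C n (Z d) * cintegral a b (G n (Z d)))
          <= 2 * pi * expR (N (rvec n) * ln q).
      move=> ab bapi abA; rewrite -cintegralZ//.
      apply: le_trans (cmod_cintegral_le (C := expR (N (rvec n) * ln q)) ab _ _) _.
      * exact: continuous_mulcl cGd.
      * move=> t /abA At; have <- := circle_integrandE n t z0 (fun j => fZ _ j Dd).
        by apply: cmod_circle_integrand_le; [exact: Nn|exact: q0|exact: Hq].
      * by have := expR_gt0 (N (rvec n) * ln q); nra.
    apply: le_trans (cmodD _ _) _; rewrite mulrN opprK.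
    have -> : 4 * pi * expR (N (rvec n) * ln q) =
      2 * pi * expR (N (rvec n) * ln q) + 2 * pi * expR (N (rvec n) * ln q) by ring.
    apply: lerD; apply: bound; try lra.
    * by move=> t te; left; rewrite /= in_itv.
    * by move=> t te; right; rewrite /= in_itv.
  rewrite (coefE n d Dd z0) (phaseE n _ _ n0 Dd z0); last first.
    by move=> t j te; apply/Re_gt0_neq0/Re_e.
  congr (_ * _); rewrite -!mulrDr; congr (_ * _).
  rewrite (@cintegral_split _ (- pi) (- e) pi)//; last by lra.
  rewrite (@cintegral_split _ (- e) e pi)//; last by lra.
  by ring.
- have Re_pi d t j : D0 d -> 0 < complex.Re (log_arg f Z t d j).
    move=> /D0D[[u [Du /= Zu]] [v /= ve uvE]] [Dd _].
    (* The vector [v] is the difference between [d] and a zero [u] of [Z] in [D], so [d] is within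
       [e2] of [u] in the norm [N]. *)
    have Zd : cmod (Z d) < del.
      rewrite -[Z d]subr0; apply: (He2 u d Du Dd Zu).
      by rewrite -uvE addrAC subrr add0r (lt_le_trans ve).
    by apply: Hdel => //; rewrite cmodM cmod_cis mulr1.
  split=> [d t j D0d _|n n0 D0n]; first exact/slit_plane_Re_gt0/Re_pi.
  have [_ /DZ0[Dd z0]] := D0D _ D0n.
  rewrite (phaseE n _ _ n0 Dd z0); first exact: coefE.
  by move=> t j _; exact/Re_gt0_neq0/Re_pi.
Qed.
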